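(* The decision problems $k$-$\mathbf{HOM}$ and $k$-$\mathbf{CORE}$ are both NP-complete.
   Context: Let $k$ be a positive natural number. A $k$-poset is an object $(P;\leq,c)$, also written $(P,c)$, where $(P;\leq)$ is a partially ordered set and $c\colon P\to\{0,1,\dots,k-1\}$ is a labeling function. A homomorphism $h\colon(P,c)\to(P',c')$ of $k$-posets is a map $h\colon P\to P'$ that preserves order ($x\leq y$ in $P$ implies $h(x)\leq h(y)$ in $P'$) and labels ($c=c'\circ h$); an endomorphism is a homomorphism from a $k$-poset to itself. Problem $k$-$\mathbf{HOM}$ (the $k$-poset homomorphism problem). Instance: $k$-posets $(P,c)$ and $(P',c')$. Question: Is there a homomorphism $(P,c)\to(P',c')$? Problem $k$-$\mathbf{CORE}$ (the $k$-poset non-coreness problem). Instance: a $k$-poset $(P,c)$. Question: Is there a nonsurjective endomorphism of $(P,c)$?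
   Formalization: The formal theorem assumes k ≥ 2 instead of k positive: for k = 1 labels are vacuous, constant maps are homomorphisms, both problems are decidable in polynomial time, and NP-completeness would amount to P = NP. *)

(* Defs.v *)
From HB Require Import structures.
From mathcomp Require Import all_boot all_order all_algebra.

Set Implicit Arguments.
Unset Strict Implicit.
Unset Printing Implicit Defensive.

(** * Deterministic multi-tape Turing machines *)

Notation word := (seq bool).

(* A tape cell is blank ([None]), an input bit, or a letter of the
   machine-specific work alphabet [A]. *)
Definition cell (A : Type) : Type := option (bool + A).

Inductive move : Type := MoveLeft | Stay | MoveRight.

(* A two-way infinite tape: [tleft] lists the cells to the left of the head
   (nearest first), [tright] those to its right; cells beyond are blank. *)
Record tape (A : Type) : Type := Tape {
  tleft : seq (cell A);
  thead : cell A;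
  tright : seq (cell A)
}.

Definition tape_write (A : Type) (a : cell A) (t : tape A) : tape A :=
  Tape (tleft t) a (tright t).

Definition tape_move (A : Type) (m : move) (t : tape A) : tape A :=
  match m with
  | MoveLeft =>
      Tape (behead (tleft t)) (head None (tleft t)) (thead t :: tright t)
  | Stay => t
  | MoveRight =>
      Tape (thead t :: tleft t) (head None (tright t)) (behead (tright t))
  end.

(* The head is on the first letter of the word. *)
Definition tape_of_word (A : Type) (w : word) : tape A :=
  let s := [seq Some (inl b) | b <- w] in Tape [::] (head None s) (behead s).

Fixpoint bits_prefix (A : Type) (s : seq (cell A)) : word :=
  if s is Some (inl b) :: s' then b :: bits_prefix s' else [::].

(* The word written from the head rightwards, up to the first non-bit. *)
Definition word_of_tape (A : Type) (t : tape A) : word :=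
  bits_prefix (thead t :: tright t).

(* States and letters form finite types, so [tm_trans] is a finite table.
   There are always at least two tapes: tape 0 holds the input, and the output
   at the end; tape 1 holds a second input (the certificate of a verifier). *)
Record tm : Type := TM {
  tm_work : nat;
  tm_sym : finType;
  tm_state : finType;
  tm_start : tm_state;
  tm_final : pred tm_state;
  tm_trans : tm_state -> {ffun 'I_tm_work.+2 -> cell tm_sym} ->
             tm_state * {ffun 'I_tm_work.+2 -> cell tm_sym * move}
}.

Record config (M : tm) : Type := Config {
  cstate : tm_state M;
  ctapes : 'I_(tm_work M).+2 -> tape (tm_sym M)
}.

Definition tm_init (M : tm) (x u : word) : config M :=
  Config (tm_start M)
    (fun i : 'I_(tm_work M).+2 =>
       tape_of_word (tm_sym M) (nth [::] [:: x; u] i)).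

Definition halted (M : tm) (c : config M) : bool := tm_final (cstate c).

(* A halted configuration does not change any more. *)
Definition tm_step (M : tm) (c : config M) : config M :=
  if halted c then c else
  let: (q, act) := tm_trans (cstate c) [ffun i => thead (ctapes c i)] in
  Config q
    (fun i => tape_move (act i).2 (tape_write (act i).1 (ctapes c i))).

(* On inputs [x], [u], the machine [M] halts after at most [t] steps with
   output [y]. *)
Definition returns_within (M : tm) (t : nat) (x u y : word) : Prop :=
  let c := iter t (@tm_step M) (tm_init M x u) in
  halted c /\ word_of_tape (ctapes c ord0) = y.

(** * Polynomial time, NP and NP-completeness *)

Definition polytime (f : word -> word) : Prop :=
  exists (M : tm) (p : {poly nat}),
    forall x, returns_within M (p.[size x])%R x [::] (f x).

Definition polytime_pred2 (v : word -> word -> bool) : Prop :=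
  exists (M : tm) (p : {poly nat}),
    forall x u, returns_within M (p.[(size x + size u)%N])%R x u [:: v x u].

Definition language : Type := word -> Prop.

(* [v] is a polynomial-time verifier, [u] a certificate of polynomial length. *)
Definition NP (L : language) : Prop :=
  exists (v : word -> word -> bool) (q : {poly nat}),
    polytime_pred2 v /\
    forall x, L x <-> exists u, size u <= (q.[size x])%R /\ v x u.

(* Polynomial-time many-one (Karp) reducibility. *)
Definition reduces_to (L L' : language) : Prop :=
  exists f : word -> word, polytime f /\ forall x, L x <-> L' (f x).

Definition NP_hard (L : language) : Prop :=
  forall L' : language, NP L' -> reduces_to L' L.

Definition NP_complete (L : language) : Prop := NP L /\ NP_hard L.

(* The language of a decision problem given by its instances, their encoding
   as words and its question; words encoding no instance are not in it. *)
Definition language_of (I : Type) (enc : I -> word) (question : I -> Prop) :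
    language :=
  fun w => exists x : I, w = enc x /\ question x.

(** * Finite k-posets *)

Record kposet (k : nat) : Type := KPoset {
  kdisp : Order.disp_t;
  kcar :> finPOrderType kdisp;
  klabel : kcar -> 'I_k
}.

Definition kposet_hom (k : nat) (P P' : kposet k) (h : P -> P') : Prop :=
  {homo h : x y / (x <= y)%O} /\ (forall x, klabel x = klabel (h x)).

(* Number of elements in unary, matrix of the order row by row, labels in
   unary.  This code is self-delimiting, and determines the k-poset up to
   isomorphism. *)
Definition kposet_enc (k : nat) (P : kposet k) : word :=
  rcons (nseq #|{: P}| true) false
  ++ [seq (x <= y)%O | x <- enum {: P}, y <- enum {: P}]
  ++ flatten [seq rcons (nseq (klabel x) true) false | x <- enum {: P}].

Definition kHOM (k : nat) : language :=
  language_of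
    (fun I : kposet k * kposet k => kposet_enc I.1 ++ kposet_enc I.2)
    (fun I => exists h : I.1 -> I.2, kposet_hom h).

Definition kCORE (k : nat) : language :=
  language_of (@kposet_enc k)
    (fun P => exists h : P -> P,
       kposet_hom h /\ ~ (forall y : P, exists x : P, h x = y)).

(* Main.v *)
Require Import Defs.
From HB Require Import structures.
From mathcomp Require Import all_boot all_order all_algebra.
From mathcomp Require Import zify.
From Stdlib Require Import FunctionalExtensionality.
Import Defs.

(** Membership in NP and the polynomial reductions both rest on one small
    language of numerical terms with bounded sums, whose values and running time
    are polynomially bounded; it is compiled to stack programs, and these to
    Turing machines, each stack being a tape read from the head rightwards.

    For hardness, let [M] verify certificates within time [T]. A run of [M] is
    described by one value of polynomial size for each time: the state and
    letters read, the length of the certificate, and for each tape the position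
    of the head and the time of its last visit there. That such a family of
    values comes from a run is a conjunction of conditions on pairs of values:
    the letter read is the one written at the last visit, and no visit occurs in
    between. So NP reduces to choosing pairwise compatible values [s t], [t <= T].

    Such a choice is in turn a homomorphism of digraphs, where each variable [t]
    has to be mapped to one of its values and all other vertices are held fixed
    by a longest directed path. Keeping the variables and the values together in
    one digraph, an endomorphism is either the identity or moves all variables to
    their values, and only then it is not surjective. Finally, digraphs without
    sources and sinks embed fully into posets labelled by 0 and 1. *)

Set Implicit Arguments.
Unset Strict Implicit.
Unset Printing Implicit Defensive.

(** * Stack programs and Turing machines *)

(** A value cannot record a tape, since there would be exponentially many of them. One head position
    and one time of last visit per tape are a fixed number of polynomially bounded numbers, and they
    suffice because a letter changes only when the head is on it. The certificate is not stored
    either: its bits are the letters read at first visits on tape 1, and a position has at most one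
    first visit. Only its length is carried along, as it decides whether such a read gives a bit or
    a blank.

    In the digraph the variables form a transitive tournament and have no edges to the values, so
    all of them move or none does. This lets one construction serve both problems: for HOM the
    domain omits the values and the target omits the variables, which forces all to move; for CORE
    nothing is omitted. The vertex [VG] that excludes sources and sinks creates 2-cycles, but as no
    others exist, it is recognized by them and fixed first.

    Running times are bounded by powers [b ^ d] of a base [b >= 2], a form closed under sums and
    products. *)

Inductive cmd : Type :=
| Push (r : nat) (b : bool)
| Pop (r : nat)
| Seq (c d : cmd)
| If (nonempty : bool) (r : nat) (c d : cmd)
| While (r : nat) (c : cmd).

Definition state := nat -> word.

Definition upd (s : state) (r : nat) (w : word) : state :=
  fun q => if q == r then w else s q.

Definition test (nonempty : bool) (w : word) : bool :=
  if nonempty then w != [::] else head false w.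

(** The costs are exact numbers of machine steps: a push moves the head left and then writes,
    sequencing is free, and every test takes one step. *)
Inductive run : cmd -> state -> nat -> state -> Prop :=
| run_push r b s : run (Push r b) s 2 (upd s r (b :: s r))
| run_pop r s : run (Pop r) s 1 (upd s r (behead (s r)))
| run_seq c d s1 s2 s3 n m :
    run c s1 n s2 -> run d s2 m s3 -> run (Seq c d) s1 (n + m) s3
| run_if k r c d s n s' :
    run (if test k (s r) then c else d) s n s' -> run (If k r c d) s n.+1 s'
| run_while0 r c s : s r = [::] -> run (While r c) s 1 s
| run_whileS r c s1 s2 s3 n m :
    s1 r <> [::] -> run c s1 n s2 -> run (While r c) s2 m s3 ->
    run (While r c) s1 (n + m).+1 s3.

Fixpoint regs_below (n : nat) (c : cmd) : bool :=
  match c with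
  | Push r _ => r < n
  | Pop r => r < n
  | Seq c d => regs_below n c && regs_below n d
  | If _ r c d => [&& r < n, regs_below n c & regs_below n d]
  | While r c => (r < n) && regs_below n c
  end.

Lemma regs_below_leq n m c : n <= m -> regs_below n c -> regs_below m c.
Proof.
move=> le_nm; elim: c => //=.
- by move=> r _ /leq_trans; apply.
- by move=> r /leq_trans; apply.
- by move=> c IHc d IHd /andP[/IHc-> /IHd->].
- by move=> k r c IHc d IHd /and3P[/leq_trans-> // /IHc-> /IHd->].
- by move=> r c IHc /andP[/leq_trans-> // /IHc->].
Qed.

Lemma regs_below_exists c : exists n, regs_below n c.
Proof.
elim: c => [r b|r|c [n Hn] d [m Hm]|k r c [n Hn] d [m Hm]|r c [n Hn]] /=.
- by exists r.+1.
- by exists r.+1.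
- by exists (maxn n m); rewrite !(regs_below_leq _ Hn, regs_below_leq _ Hm) ?leq_max ?leqnn ?orbT.
- exists (maxn r.+1 (maxn n m)).
  by rewrite !(regs_below_leq _ Hn, regs_below_leq _ Hm) ?leq_max ?leqnn ?orbT.
- exists (maxn r.+1 n).
  by rewrite !(regs_below_leq _ Hn) ?leq_max ?leqnn ?orbT.
Qed.

(** * Compilation of stack programs to Turing machines *)

Section Compilation.

Variable n : nat.

Local Notation I := 'I_n.+2.
Local Notation C := (cell void).
Local Notation tapes := (I -> tape void).

(** A program position is a path into the syntax tree, so the states are finite by construction.
    [None] is the test of an [If] or a [While]; the two states of [Push] are before and after the
    move to the left. *)
Fixpoint pc (c : cmd) : finType :=
  match c with
  | Push _ _ => bool : finType
  | Pop _ => unit : finType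
  | Seq c d => (pc c + pc d)%type : finType
  | If _ _ c d => option (pc c + pc d)%type : finType
  | While _ c => option (pc c) : finType
  end.

Fixpoint entry (c : cmd) : pc c :=
  match c with
  | Push _ _ => false
  | Pop _ => tt
  | Seq c d => inl (entry c)
  | If _ _ c d => None
  | While _ c => None
  end.

Definition act_on (r : nat) (a : C) (m : move) (rd : {ffun I -> C}) :
    {ffun I -> C * move} :=
  [ffun i : I => if val i == r then (a, m) else (rd i, Stay)].

Definition idle (rd : {ffun I -> C}) : {ffun I -> C * move} :=
  [ffun i : I => (rd i, Stay)].

Definition test_cell (nonempty : bool) (a : C) : bool :=
  if a is Some (inl b) then nonempty || b else false.

(* [None] as next program counter means that the command is finished. *)
Fixpoint next (c : cmd) :
    pc c -> {ffun I -> C} -> option (pc c) * {ffun I -> C * move} :=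
  match c return pc c -> {ffun I -> C} -> option (pc c) * {ffun I -> C * move} with
  | Push r b => fun s rd =>
      if s then (None, act_on r (Some (inl b)) Stay rd)
      else (Some true, act_on r (rd (inord r)) MoveLeft rd)
  | Pop r => fun s rd => (None, act_on r None MoveRight rd)
  | Seq c d => fun s rd =>
      match s with
      | inl s => let: (s', a) := next s rd in
                 (Some (if s' is Some s' then inl s' else inr (entry d)), a)
      | inr s => let: (s', a) := next s rd in (omap inr s', a)
      end
  | If k r c d => fun s rd =>
      match s with
      | None => (Some (Some (if test_cell k (rd (inord r))
                             then inl (entry c) else inr (entry d))), idle rd)
      | Some (inl s) => let: (s', a) := next s rd in
                        (omap (fun s' => Some (inl s')) s', a)
      | Some (inr s) => let: (s', a) := next s rd in
                        (omap (fun s' => Some (inr s')) s', a)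
      end
  | While r c => fun s rd =>
      match s with
      | None => (if rd (inord r) is Some _ then Some (Some (entry c)) else None,
                 idle rd)
      | Some s => let: (s', a) := next s rd in (Some s', a)
      end
  end.

Definition reads (T : tapes) : {ffun I -> C} := [ffun i => thead (T i)].

Definition perform (a : {ffun I -> C * move}) (T : tapes) : tapes :=
  fun i => tape_move (a i).2 (tape_write (a i).1 (T i)).

Inductive lrun (c : cmd) : pc c -> tapes -> nat -> tapes -> Prop :=
| lrun1 s T a : next s (reads T) = (None, a) -> lrun s T 1 (perform a T)
| lrunS s s' T a k T' : next s (reads T) = (Some s', a) ->
    lrun s' (perform a T) k T' -> lrun s T k.+1 T'.

Lemma lrun_seqr c d (s : pc d) T k T' :
  lrun s T k T' -> @lrun (Seq c d) (inr s) T k T'.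
Proof.
elim=> {s T k T'} [s T a E|s s' T a k T' E _ IH].
  by apply: lrun1; rewrite /= E.
by apply: lrunS IH; rewrite /= E.
Qed.

(** The step that finishes [c] already enters [d], so the times just add up. *)
Lemma lrun_seql c d (s : pc c) T k T' m T'' :
  lrun s T k T' -> @lrun (Seq c d) (inr (entry d)) T' m T'' ->
  @lrun (Seq c d) (inl s) T (k + m) T''.
Proof.
move=> H; elim: H m T'' => {s T k T'} [s T a E|s s' T a k T' E _ IH] m T'' H.
  by apply: lrunS H; rewrite /= E.
by rewrite addSn; apply: lrunS (IH _ _ H); rewrite /= E.
Qed.

Lemma lrun_ifl k r c d (s : pc c) T t T' :
  lrun s T t T' -> @lrun (If k r c d) (Some (inl s)) T t T'.
Proof.
elim=> {s T t T'} [s T a E|s s' T a t T' E _ IH].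
  by apply: lrun1; rewrite /= E.
by apply: lrunS IH; rewrite /= E.
Qed.

Lemma lrun_ifr k r c d (s : pc d) T t T' :
  lrun s T t T' -> @lrun (If k r c d) (Some (inr s)) T t T'.
Proof.
elim=> {s T t T'} [s T a E|s s' T a t T' E _ IH].
  by apply: lrun1; rewrite /= E.
by apply: lrunS IH; rewrite /= E.
Qed.

Lemma lrun_body r c (s : pc c) T k T' m T'' :
  lrun s T k T' -> @lrun (While r c) None T' m T'' ->
  @lrun (While r c) (Some s) T (k + m) T''.
Proof.
move=> H; elim: H m T'' => {s T k T'} [s T a E|s s' T a k T' E _ IH] m T'' H.
  by apply: lrunS H; rewrite /= E.
by rewrite addSn; apply: lrunS (IH _ _ H); rewrite /= E.
Qed.

Lemma perform_idle T : perform (idle (reads T)) T = T.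
Proof.
apply: functional_extensionality => i.
by rewrite /perform /idle /reads !ffunE /=; case: (T i).
Qed.

(* The stack is on the tape from the head rightwards, top first. *)
Definition stack_on (t : tape void) (w : word) : Prop :=
  exists i j, tleft t = nseq i None /\
    thead t :: tright t = [seq Some (inl b) | b <- w] ++ nseq j None.

Definition stacks_on (T : tapes) (s : state) : Prop :=
  forall i : I, stack_on (T i) (s i).

Lemma stack_on_head t w : stack_on t w -> thead t = ohead [seq inl b | b <- w].
Proof.
case=> i [j [_]]; case: w => [|b w] /=; last by case.
by case: j => //= j [].
Qed.

Lemma stack_on_push t w b : stack_on t w ->
  stack_on (tape_write (Some (inl b))
             (tape_move MoveLeft (tape_write (thead t) t))) (b :: w).
Proof.
case: t => l h r [i [j [/= -> E]]]; exists i.-1, j; split; first by case: i.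
by rewrite /= E.
Qed.

(** Popping leaves a blank behind on the left. On an empty stack the head only wanders over blanks,
    so popping it changes nothing. *)
Lemma stack_on_pop t w : stack_on t w ->
  stack_on (tape_move MoveRight (tape_write None t)) (behead w).
Proof.
case: t => l h r [i [j [/= -> E]]]; exists i.+1; case: w E => [|b w] /=.
  case: j => // j [_ ->]; exists (maxn j 1); split => //.
  by case: j.
(* An exhausted list reveals one of the implicit blanks, which now has to be counted. *)
case=> _ ->; exists (if (w == [::]) && (j == 0) then 1 else j); split => //.
by case: w => //=; case: j.
Qed.

Lemma stacks_on_act r T s a w m : r < n.+2 -> stacks_on T s ->
  stack_on (tape_move m (tape_write a (T (inord r)))) w ->
  stacks_on (perform (act_on r a m (reads T)) T) (upd s r w).
Proof.
move=> lt_r Ts Tw i; rewrite /perform /act_on /upd ffunE.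
case: eqP => [Ei|_] /=; first by rewrite -Ei inord_val in Tw.
by rewrite /reads ffunE; case: (T i) (Ts i).
Qed.

Lemma perform_act r a m a' m' T : r < n.+2 ->
  perform (act_on r a' m' (reads (perform (act_on r a m (reads T)) T)))
    (perform (act_on r a m (reads T)) T) =
  fun i => if val i == r then
    tape_move m' (tape_write a' (tape_move m (tape_write a (T i)))) else T i.
Proof.
move=> lt_r; apply: functional_extensionality => i.
rewrite /perform /act_on /reads !ffunE /=; case: ifP => Ei /=.
  by [].
by rewrite Ei; case: (T i).
Qed.

Lemma reads_stack r T s : r < n.+2 -> stacks_on T s ->
  reads T (inord r) = ohead [seq inl b | b <- s r].
Proof.
by move=> lt_r Ts; rewrite /reads ffunE (stack_on_head (Ts _)) inordK.
Qed.

Lemma run_lrun c s k s' T : run c s k s' -> regs_below n.+2 c ->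
  stacks_on T s -> exists2 T', lrun (entry c) T k T' & stacks_on T' s'.
Proof.
move=> H; elim: H T => {c s k s'} /=.
- move=> r b s T lt_r Ts; eexists; first by apply: lrunS => //; apply: lrun1.
  rewrite perform_act // => i; rewrite /upd /=; case: eqP => // Ei.
  rewrite -Ei inord_val ffunE; apply: stack_on_push; exact: Ts.
- move=> r s T lt_r Ts; eexists; first exact: lrun1.
  apply: stacks_on_act => //; apply: stack_on_pop.
  by have := Ts (inord r); rewrite inordK.
- move=> c d s1 s2 s3 k m _ IHc _ IHd T /andP[okc okd].
  case/(IHc _ okc) => T' Hc /(IHd _ okd)[T'' Hd T''s]; exists T'' => //.
  by apply: lrun_seql Hc _; apply: lrun_seqr.
- move=> k r c d s t s' _ IH T /and3P[lt_r okc okd] Ts.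
  have [|T' HT T's] := IH T _ Ts; first by case: ifP.
  exists T' => //; apply: (@lrunS (If k r c d)).
    by rewrite /=; reflexivity.
  rewrite perform_idle (reads_stack lt_r Ts).
  have -> : test_cell k (ohead [seq inl b | b <- s r]) = test k (s r).
    by rewrite /test; case: (s r) => [|b w]; case: (k).
  by case: ifP HT => _; [exact: lrun_ifl | exact: lrun_ifr].
- move=> r c s s0 T /andP[lt_r okc] Ts; exists T => //.
  rewrite -[T in lrun _ _ _ T]perform_idle; apply: lrun1 => /=.
  by rewrite (reads_stack lt_r Ts) s0.
- move=> r c s1 s2 s3 k m s1n _ IHc _ IHw T ok /[dup] Ts.
  have /andP[lt_r okc] := ok.
  case/(IHc _ okc) => T' Hc /(IHw _ ok)[T'' Hd T''s]; exists T'' => //.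
  case E: (s1 r) s1n => [|b w] // _; apply: (@lrunS (While r c)).
    by rewrite /= (reads_stack lt_r Ts) E; reflexivity.
  by rewrite perform_idle; apply: lrun_body Hc Hd.
Qed.

Definition machine (c : cmd) : tm :=
  @TM n void (option (pc c)) (Some (entry c)) (fun q => ~~ isSome q)
    (fun q rd => if q is Some s then next s rd else (None, idle rd)).

Lemma lrun_machine c (s : pc c) T k T' : lrun s T k T' ->
  iter k (@tm_step (machine c)) (@Config (machine c) (Some s) T) =
  @Config (machine c) None T'.
Proof.
elim=> {s T k T'} [s T a E|s s' T a k T' E _ IH].
  by rewrite /= /tm_step /= -/(reads T) E.
by rewrite iterSr /tm_step /= -/(reads T) E; exact: IH.
Qed.

End Compilation.

Definition input_state (x u : word) : state := nth [::] [:: x; u].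

Lemma bits_prefix_stack w j :
  bits_prefix ([seq Some (inl b) | b <- w] ++ nseq j (None : cell void)) = w.
Proof. by elim: w => [|b w /= ->] //; case: j. Qed.

Lemma iter_halted (M : tm) k (c : config M) :
  halted c -> iter k (@tm_step M) c = c.
Proof. by move=> Hc; elim: k => //= k ->; rewrite /tm_step Hc. Qed.

Lemma run_returns_within c : exists M : tm, forall x u k t s', k <= t ->
  run c (input_state x u) k s' -> returns_within M t x u (s' 0).
Proof.
have [n Hn] := regs_below_exists c; exists (machine n c) => x u k t s' le_kt Hr.
have ok : regs_below n.+2 c by apply: regs_below_leq Hn; lia.
have [T0 HT0 T0s] : exists2 T, tm_init (machine n c) x u =
    @Config (machine n c) (Some (entry c)) T & stacks_on T (input_state x u).
  eexists; first reflexivity.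
  move=> i; rewrite /tape_of_word /input_state.
  case: (nth _ _ _) => [|b w]; first by exists 0, 1.
  by exists 0, 0; rewrite cats0.
have [T' /lrun_machine HT' T's] := run_lrun Hr ok T0s.
rewrite /returns_within HT0 -(subnK le_kt) iterD HT' iter_halted //=; split=> //.
have [i [j [_ E]]] := T's ord0.
by rewrite /word_of_tape E bits_prefix_stack.
Qed.

(** * Time bounds and basic stack routines *)

Definition runs_in (c : cmd) (s : state) (t : nat) (s' : state) : Prop :=
  exists2 k, k <= t & run c s k s'.

Lemma runs_in_weaken c s t s' t' : t <= t' -> runs_in c s t s' -> runs_in c s t' s'.
Proof. by move=> le_tt' [k le_kt H]; exists k => //; apply: leq_trans le_tt'. Qed.

Lemma runs_in_push r b s : runs_in (Push r b) s 2 (upd s r (b :: s r)).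
Proof. by exists 2 => //; apply: run_push. Qed.

Lemma runs_in_pop r s : runs_in (Pop r) s 1 (upd s r (behead (s r))).
Proof. by exists 1 => //; apply: run_pop. Qed.

Lemma runs_in_seq c d s1 s2 s3 t t' :
  runs_in c s1 t s2 -> runs_in d s2 t' s3 -> runs_in (Seq c d) s1 (t + t') s3.
Proof.
move=> [k le_kt Hc] [k' le_kt' Hd]; exists (k + k'); first exact: leq_add.
exact: run_seq Hc Hd.
Qed.

Lemma runs_in_if k r c d s t s' :
  runs_in (if test k (s r) then c else d) s t s' ->
  runs_in (If k r c d) s (t + 1) s'.
Proof.
by move=> [m le_mt H]; exists m.+1; [rewrite addn1 | apply: run_if].
Qed.

(** The loop invariant is an explicit sequence of states, [f i] being the state after [i] rounds. *)
Lemma runs_in_while r c (f : nat -> state) n t :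
  (forall i, i < n -> f i r <> [::] /\ runs_in c (f i) t (f i.+1)) ->
  f n r = [::] -> runs_in (While r c) (f 0) (n * (t + 1) + 1) (f n).
Proof.
elim: n f => [|n IH] f Hf fn; first by exists 1 => //; apply: run_while0.
have [f0 [k le_kt Hc]] := Hf 0 isT.
have [|k' le_k' Hw] := IH (fun i => f i.+1) _ fn.
  by move=> i lt_in; apply: Hf.
exists (k + k').+1; first by rewrite mulSn; lia.
exact: run_whileS f0 Hc Hw.
Qed.

Lemma runs_in_eq c s t s' s'' : runs_in c s t s' -> s' = s'' -> runs_in c s t s''.
Proof. by move=> H <-. Qed.

Lemma updE s r w q : upd s r w q = if q == r then w else s q. Proof. by []. Qed.

Lemma upd_same s r w : upd s r w r = w. Proof. by rewrite updE eqxx. Qed.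

Lemma upd_other s r w q : q != r -> upd s r w q = s q.
Proof. by rewrite updE => /negbTE->. Qed.

Definition Move1 (q p : nat) : cmd :=
  Seq (If false q (Push p true) (Push p false)) (Pop q).

Lemma runs_in_Move1 q p s b w : q != p -> s q = b :: w ->
  runs_in (Move1 q p) s 4 (upd (upd s q w) p (b :: s p)).
Proof.
move=> ne_qp sq; apply: (runs_in_eq (s' := upd (upd s p (b :: s p)) q w)).
  apply: (runs_in_seq (t := 3) (t' := 1) (s2 := upd s p (b :: s p))).
    apply: (runs_in_if (t := 2)); rewrite sq /=; case: b {sq}; exact: runs_in_push.
  apply: (runs_in_eq (runs_in_pop _ _)).
  by rewrite upd_other // sq.
apply: functional_extensionality => x; rewrite !updE.
by case: eqP => // ->; rewrite (negbTE ne_qp).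
Qed.

(** The bits arrive in reverse order; a second move restores it. *)
Definition Move (q p : nat) : cmd := While q (Move1 q p).

Lemma runs_in_Move q p s : q != p ->
  runs_in (Move q p) s (5 * size (s q) + 1)
    (upd (upd s q [::]) p (catrev (s q) (s p))).
Proof.
move=> ne_qp.
pose f i := upd (upd s q (drop i (s q))) p (catrev (take i (s q)) (s p)).
have fq i : f i q = drop i (s q) by rewrite /f upd_other // upd_same.
have f0 : f 0 = s.
  apply: functional_extensionality => x.
  by rewrite /f !updE drop0 take0 /=; do 2 case: eqP => [->|] //.
have := @runs_in_while q (Move1 q p) f (size (s q)) 4.
rewrite fq f0 [X in runs_in (While _ _) _ _ X]/f drop_size take_size mulnC; apply=> // i lt_i.
have fi : f i q = nth false (s q) i :: drop i.+1 (s q).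
  by rewrite fq (drop_nth false).
split; first by rewrite fi.
apply: (runs_in_eq (runs_in_Move1 ne_qp fi)).
apply: functional_extensionality => x; rewrite /f !updE eqxx.
case: eqP => _; last by case: eqP.
by rewrite (take_nth false) // !catrevE rev_rcons.
Qed.

(** Truncated subtraction of unary numbers, as popping an empty stack changes nothing. *)
Definition Drop (q p : nat) : cmd := While q (Seq (Pop q) (Pop p)).

Lemma runs_in_Drop q p s : q != p ->
  runs_in (Drop q p) s (3 * size (s q) + 1)
    (upd (upd s q [::]) p (drop (size (s q)) (s p))).
Proof.
move=> ne_qp.
pose f i := upd (upd s q (drop i (s q))) p (drop i (s p)).
have fq i : f i q = drop i (s q) by rewrite /f upd_other // upd_same.
have f0 : f 0 = s.
  apply: functional_extensionality => x.
  by rewrite /f !updE !drop0; do 2 case: eqP => [->|] //.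
have := @runs_in_while q (Seq (Pop q) (Pop p)) f (size (s q)) 2.
rewrite fq f0 [X in runs_in (While _ _) _ _ X]/f drop_size mulnC; apply=> // i lt_i.
split; first by rewrite fq (drop_nth false).
apply: (runs_in_eq (runs_in_seq (runs_in_pop _ _) (runs_in_pop _ _))).
apply: functional_extensionality => x; rewrite /f !updE !eqxx.
rewrite (negbTE ne_qp) [p == q]eq_sym (negbTE ne_qp).
by rewrite -!drop1 !drop_drop !add1n; do 2 case: eqP => //.
Qed.

Definition Clear (q : nat) : cmd := While q (Pop q).

Lemma runs_in_Clear q s :
  runs_in (Clear q) s (2 * size (s q) + 1) (upd s q [::]).
Proof.
pose f i := upd s q (drop i (s q)).
have f0 : f 0 = s.
  by apply: functional_extensionality => x; rewrite /f !updE drop0; case: eqP => [->|].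
have := @runs_in_while q (Pop q) f (size (s q)) 1.
rewrite f0 [f (size _)]/f upd_same drop_size mulnC; apply=> // i lt_i.
rewrite /f upd_same; split; first by rewrite (drop_nth false).
apply: (runs_in_eq (runs_in_pop _ _)).
apply: functional_extensionality => x; rewrite !updE eqxx -drop1 drop_drop add1n.
by case: eqP.
Qed.

(** Reading [q] is destructive, so its bits wait on [p] and are put back at the end. *)
Definition Measure (q t p : nat) : cmd :=
  Seq (While q (Seq (Move1 q p) (Push t true))) (Move p q).

Lemma runs_in_Measure q t p s : q != p -> q != t -> p != t -> s p = [::] ->
  runs_in (Measure q t p) s (12 * size (s q) + 2)
    (upd s t (nseq (size (s q)) true ++ s t)).
Proof.
move=> ne_qp ne_qt ne_pt sp.
pose f i := upd (upd (upd s q (drop i (s q))) p (rev (take i (s q))))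
              t (nseq i true ++ s t).
have fq i : f i q = drop i (s q).
  by rewrite /f upd_other // upd_other // upd_same.
have f0 : f 0 = s.
  apply: functional_extensionality => x.
  rewrite /f !updE drop0 take0 /=.
  by case: eqP => [->|_] //; case: eqP => [->|_] //; case: eqP => [->|_].
have := @runs_in_while q (Seq (Move1 q p) (Push t true)) f (size (s q)) 6.
rewrite f0 fq drop_size => H.
have {H} := H _ erefl; case.
  move=> i lt_i; split; first by rewrite fq (drop_nth false).
  have fi : f i q = nth false (s q) i :: drop i.+1 (s q).
    by rewrite fq (drop_nth false).
  apply: (runs_in_eq (runs_in_seq (runs_in_Move1 ne_qp fi) (runs_in_push _ _ _))).
  apply: functional_extensionality => x.
  rewrite /f !updE !eqxx (negbTE ne_pt) [t == p]eq_sym (negbTE ne_pt).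
  rewrite [t == q]eq_sym (negbTE ne_qt).
  case: eqP => // _; case: eqP => // _; last by case: eqP.
  by rewrite (take_nth false) // rev_rcons.
move=> k le_k Hk; apply: (runs_in_weaken (t := 7 * size (s q) + 1 + (5 * size (s q) + 1))).
  lia.
apply: (runs_in_seq (s2 := f (size (s q)))).
  by exists k => //; rewrite mulnC.
have := @runs_in_Move p q (f (size (s q))); rewrite eq_sym => /(_ ne_qp).
have -> : f (size (s q)) p = rev (s q).
  by rewrite /f upd_other // upd_same take_size.
rewrite size_rev fq drop_size => H; apply: (runs_in_eq H).
apply: functional_extensionality => x.
rewrite /f !updE drop_size take_size !catrevE revK cats0.
case: eqP => [->|]; first by rewrite (negbTE ne_qt).
by case: eqP => [->|_ _]; rewrite ?(negbTE ne_pt) ?sp.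
Qed.

(** The second branch pops an empty register, which is a way to skip. *)
Definition Skim1 (q p : nat) : cmd := If true q (Move1 q p) (Pop q).

Definition Skim (i q p : nat) : cmd := While i (Seq (Pop i) (Skim1 q p)).

Lemma runs_in_Skim i q p s : i != q -> i != p -> q != p ->
  runs_in (Skim i q p) s (7 * size (s i) + 1)
    (upd (upd (upd s i [::]) q (drop (size (s i)) (s q)))
       p (catrev (take (size (s i)) (s q)) (s p))).
Proof.
move=> ne_iq ne_ip ne_qp.
pose f j := upd (upd (upd s i (drop j (s i))) q (drop j (s q)))
              p (catrev (take j (s q)) (s p)).
have fi j : f j i = drop j (s i).
  by rewrite /f upd_other // upd_other // upd_same.
have f0 : f 0 = s.
  apply: functional_extensionality => x.
  rewrite /f !updE !drop0 take0 /=.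
  by case: eqP => [->|_] //; case: eqP => [->|_] //; case: eqP => [->|_].
have := @runs_in_while i (Seq (Pop i) (Skim1 q p)) f (size (s i)) 6.
rewrite f0 fi drop_size mulnC => H.
apply: (runs_in_eq (s' := f (size (s i)))); last by rewrite /f drop_size.
apply: H => // j lt_j.
split; first by rewrite fi (drop_nth false).
set s1 := upd (f j) i (drop j.+1 (s i)).
have s1q : s1 q = drop j (s q).
  by rewrite /s1 upd_other 1?eq_sym // /f upd_other // upd_same.
have s1p : s1 p = catrev (take j (s q)) (s p).
  by rewrite /s1 upd_other 1?eq_sym // /f upd_same.
apply: (runs_in_seq (t := 1) (t' := 5) (s2 := s1)).
  apply: (runs_in_eq (runs_in_pop _ _)).
  by rewrite fi -drop1 drop_drop add1n.
apply: (runs_in_if (t := 4)); rewrite /test s1q.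
have [lt_jq|le_qj] := ltnP j (size (s q)); last first.
  rewrite drop_oversize //; apply: (runs_in_weaken (t := 1)) => //.
  apply: (runs_in_eq (runs_in_pop _ _)).
  apply: functional_extensionality => x; rewrite s1q /s1 /f !updE.
  rewrite !(drop_oversize (s := s q)) ?(leqW le_qj) //=.
  rewrite !(take_oversize (s := s q)) ?(leqW le_qj) //.
  have [->|nq] := eqVneq x q; first by rewrite (negbTE ne_qp).
  have [->|//] := eqVneq x i; by rewrite (negbTE ne_ip).
rewrite (drop_nth false lt_jq) /= in s1q *; apply: (runs_in_eq (runs_in_Move1 ne_qp s1q)).
apply: functional_extensionality => x; rewrite s1p /s1 /f !updE.
have [_|_] := eqVneq x p.
  by rewrite (take_nth false) // !catrevE rev_rcons.
have [_//|_] := eqVneq x q.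
by have [_|_] := eqVneq x i.
Qed.

(** [Skim] has emptied [i], so [Pop i] is a skip. Beyond the end of the word the test fails, in
    accordance with the default of [nth false]. *)
Definition FetchBit (i q t p : nat) : cmd :=
  Seq (Skim i q p) (Seq (If false q (Push t true) (Pop i)) (Move p q)).

Lemma runs_in_FetchBit i q t p s : uniq [:: i; q; t; p] -> s p = [::] ->
  runs_in (FetchBit i q t p) s (12 * size (s i) + 5)
    (upd (upd s i [::]) t (nseq (nth false (s q) (size (s i))) true ++ s t)).
Proof.
rewrite /= !inE !negb_or !andbT => /and3P[/and3P[ne_iq ne_it ne_ip]].
move=> /andP[ne_qt ne_qp] ne_tp sp; set n := size (s i).
apply: (runs_in_weaken (t := 7 * n + 1 + (3 + (5 * n + 1)))); first by lia.
have := runs_in_Skim s ne_iq ne_ip ne_qp; rewrite -/n; set s1 := (X in runs_in _ _ _ X).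
move=> H; apply: runs_in_seq H _.
set s2 := upd s1 t (nseq (nth false (s q) n) true ++ s1 t).
have s1q : s1 q = drop n (s q) by rewrite /s1 upd_other // upd_same.
apply: (runs_in_seq (s2 := s2)).
  apply: (runs_in_if (t := 2)); rewrite /test s1q /s2.
  rewrite -nth0 nth_drop addn0; case: (nth _ _ _); first exact: runs_in_push.
  apply: (runs_in_weaken (t := 1)) => //; apply: (runs_in_eq (runs_in_pop _ _)).
  have s1i : s1 i = [::] by rewrite /s1 upd_other // upd_other // upd_same.
  apply: functional_extensionality => x; rewrite !updE s1i /=.
  have [->|_] := eqVneq x t; first by rewrite eq_sym (negbTE ne_it).
  by have [->|] := eqVneq x i.
have s2p : s2 p = rev (take n (s q)).
  by rewrite /s2 upd_other 1?eq_sym // /s1 upd_same sp catrevE cats0.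
apply: (runs_in_weaken (t := 5 * size (s2 p) + 1)).
  by rewrite s2p size_rev leq_add2r leq_mul2l /= size_take_min geq_minl.
have ne_pq : p != q by rewrite eq_sym.
apply: (runs_in_eq (runs_in_Move _ ne_pq)); rewrite s2p.
apply: functional_extensionality => x; rewrite /s2 /s1 !updE.
rewrite catrevE revK eqxx (negbTE ne_qp) (negbTE ne_qt) cat_take_drop.
rewrite (negbTE ne_tp) [t == q]eq_sym (negbTE ne_qt) [t == i]eq_sym (negbTE ne_it).
have [->|nq] := eqVneq x q.
  by rewrite (negbTE ne_qt) eq_sym (negbTE ne_iq).
have [->|np] := eqVneq x p; last by [].
by rewrite eq_sym (negbTE ne_tp) eq_sym (negbTE ne_ip) sp.
Qed.

(** * Numerical terms computable in polynomial time *)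

(* Numerical terms over two words; in [EBit w e] and [ESize w], [w] selects the
   word, and [ESum e e'] sums [e'] over the new variable 0 below [e]. *)
Inductive expr : Type :=
| EVar (i : nat)
| EOne
| EAdd (e e' : expr)
| ESub (e e' : expr)
| ESum (e e' : expr)
| EBit (w : bool) (e : expr)
| ESize (w : bool).

Section Eval.

Variables x u : word.

Definition input (w : bool) : word := if w then u else x.

Fixpoint eval (r : seq nat) (e : expr) : nat :=
  match e with
  | EVar i => nth 0 r i
  | EOne => 1
  | EAdd e e' => eval r e + eval r e'
  | ESub e e' => eval r e - eval r e'
  | ESum e e' => \sum_(i < eval r e) eval (val i :: r) e'
  | EBit w e => nth false (input w) (eval r e)
  | ESize w => size (input w)
  end.

End Eval.

(* [env] lists the registers of the variables; the result goes to register [t]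
   and all registers above [t] are scratch. *)
Fixpoint compile (env : seq nat) (t : nat) (e : expr) : cmd :=
  match e with
  | EVar i => if i < size env then Measure (nth 0 env i) t t.+1 else Pop t
  | EOne => Push t true
  | EAdd e e' => Seq (compile env t e) (Seq (compile env t.+1 e') (Move t.+1 t))
  | ESub e e' => Seq (compile env t e) (Seq (compile env t.+1 e') (Drop t.+1 t))
  | ESum e e' =>
      Seq (compile env t.+1 e)
        (Seq (While t.+1
                (Seq (Pop t.+1)
                   (Seq (compile (t.+2 :: env) t.+3 e')
                      (Seq (Move t.+3 t) (Push t.+2 true)))))
           (Clear t.+2))
  | EBit w e => Seq (compile env t.+1 e) (FetchBit t.+1 w t t.+2)
  | ESize w => Measure w t t.+1
  end.

(** What compiled code expects. Emptiness from [t] on allows a result to be built up by pushing;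
    variables sit above registers 0 and 1, which keep the inputs. *)
Definition ready (x u : word) (r env : seq nat) (t : nat) (s : state) : Prop :=
  [/\ forall w : bool, s w = input x u w,
      size env = size r,
      forall i, i < size env ->
        1 < nth 0 env i < t /\ s (nth 0 env i) = nseq (nth 0 r i) true
    & forall q, t <= q -> s q = [::]].

Lemma ready_upd x u r env t s q w : 1 < t -> t <= q ->
  ready x u r env t s -> ready x u r env q.+1 (upd s q w).
Proof.
move=> lt1t le_tq [Hin Hsz Henv Hfree]; split=> // [v|i lt_i|p lt_qp].
- by rewrite upd_other //; apply/eqP; case: v => /= E; lia.
- have [/andP[-> lt_t] E] := Henv i lt_i; split; first by lia.
  by rewrite upd_other //; apply/eqP; lia.
- by rewrite upd_other ?Hfree //; [lia | apply/eqP; lia].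
Qed.

Lemma ready_weaken x u r env t t' s : t <= t' ->
  ready x u r env t s -> ready x u r env t' s.
Proof.
move=> le_tt' [Hin Hsz Henv Hfree]; split=> // [i lt_i|p lt_p].
- by have [/andP[-> lt_t] E] := Henv i lt_i; split => //; lia.
- by apply: Hfree; lia.
Qed.

(** * Bounds by powers of a common base *)

Section Powers.

Variable b : nat.
Hypothesis b_gt1 : 1 < b.

Lemma leq_pow_mono i j : i <= j -> b ^ i <= b ^ j.
Proof. by move=> le_ij; rewrite leq_exp2l. Qed.

Lemma leq_pow_add n m i j : n <= b ^ i -> m <= b ^ j -> n + m <= b ^ (i + j).+1.
Proof.
move=> Hn Hm; apply: (@leq_trans (2 * b ^ (i + j))); last by rewrite expnS leq_mul2r b_gt1 orbT.
rewrite mul2n -addnn; apply: leq_add.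
  by apply: leq_trans Hn _; apply: leq_pow_mono; apply: leq_addr.
by apply: leq_trans Hm _; apply: leq_pow_mono; apply: leq_addl.
Qed.

Lemma leq_pow_mul n m i j : n <= b ^ i -> m <= b ^ j -> n * m <= b ^ (i + j).
Proof. by move=> Hn Hm; rewrite expnD; apply: leq_mul. Qed.

Lemma leq_pow_const c : c <= b ^ c.
Proof. exact/ltnW/ltn_expl. Qed.

Lemma leq_pow_exp n i d : n <= b ^ i -> n ^ d <= b ^ (i * d).
Proof. by move=> Hn; rewrite expnM; case: d => // d; rewrite leq_exp2r. Qed.

End Powers.

(** Proves [n <= b ^ ?d] along the structure of [n] and thereby finds the exponent, left open as an
    existential variable. *)
Ltac powers :=
  repeat first [ eassumption
    | eapply leq_pow_add; [eassumption | |] | eapply leq_pow_mul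
    
    | apply leq_pow_const; eassumption ].

(** The base of all bounds; the summand 2 makes it greater than 1, as [leq_pow_add] requires. *)
Definition weight (x u : word) (r : seq nat) : nat :=
  size x + size u + sumn r + 2.

Lemma weight_gt1 x u r : 1 < weight x u r.
Proof. by rewrite /weight; lia. Qed.

Lemma nth_leq_sumn r i : nth 0 r i <= sumn r.
Proof.
elim: r i => [|a r IH] [|i] //=; first exact: leq_addr.
exact: leq_trans (IH i) (leq_addl _ _).
Qed.

Lemma sum_leq n (F : nat -> nat) B : (forall i, i < n -> F i <= B) ->
  \sum_(i < n) F i <= n * B.
Proof.
move=> HF; apply: (@leq_trans (\sum_(i < n) B)).
  by apply: leq_sum => i _; apply: HF.
by rewrite sum_nat_const card_ord.
Qed.

Lemma catrev_nseq n m (a : bool) : catrev (nseq n a) (nseq m a) = nseq (n + m) a.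
Proof. by elim: n m => //= n IH m; rewrite (IH m.+1) addnS. Qed.

Lemma succ_neq n :
  ((n.+1 == n) = false) * ((n == n.+1) = false) * ((n.+2 == n) = false) *
  ((n == n.+2) = false) * ((n.+3 == n) = false) * ((n == n.+3) = false).
Proof. by do !split; apply/eqP; lia. Qed.

(** Value and time are bounded together, because the value of the first term of an [ESum] is the
    number of rounds and bounds the new variable of the body. The exponent depends on the term
    only. *)
Lemma compile_poly e : exists d, forall x u r,
  eval x u r e <= weight x u r ^ d /\
  forall env t s, 1 < t -> ready x u r env t s ->
    runs_in (compile env t e) s (weight x u r ^ d)
      (upd s t (nseq (eval x u r e) true)).
Proof.
elim: e => [i||e [d1 IH1] e' [d2 IH2]|e [d1 IH1] e' [d2 IH2]
           |e [d1 IH1] e' [d2 IH2]|w e [d1 IH1]|w].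
- evar (d : nat); exists d => x u r; have b1 := weight_gt1 x u r.
  have le_b : nth 0 r i <= weight x u r ^ 1.
    by rewrite expn1 /weight; have := nth_leq_sumn r i; lia.
  move: (weight x u r) b1 le_b => b b1 le_b.
  have T : 12 * nth 0 r i + 2 <= b ^ d by rewrite /d; powers.
  split; first by apply: leq_trans T => /=; lia.
  move=> env t s lt1t [Hin Hsz Henv Hfree] /=; apply: runs_in_weaken T _.
  case: ifP => lt_i; last first.
    rewrite nth_default; last by rewrite -Hsz leqNgt lt_i.
    apply: (runs_in_weaken (t := 1)); first by lia.
    by apply: (runs_in_eq (runs_in_pop _ _)); rewrite Hfree.
  have [/andP[H1 H2] E] := Henv _ lt_i.
  have := @runs_in_Measure (nth 0 env i) t t.+1 s.
  rewrite E size_nseq (Hfree t) // cats0; apply; try (by apply/eqP; lia).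
  exact: Hfree.
- exists 2 => x u r; have b1 := weight_gt1 x u r; split.
    exact: leq_trans (leq_pow_const b1 2).
  move=> env t s lt1t [Hin Hsz Henv Hfree] /=.
  apply: runs_in_weaken (leq_pow_const b1 2) _.
  by apply: (runs_in_eq (runs_in_push _ _ _)); rewrite Hfree.
- evar (d : nat); exists d => x u r; have b1 := weight_gt1 x u r.
  have [V1 R1] := IH1 x u r; have [V2 R2] := IH2 x u r.
  rewrite [eval _ _ _ (EAdd _ _)]/=.
  move: (eval x u r e) (eval x u r e') V1 V2 R1 R2.
  move: (weight x u r) b1 => b b1 v1 v2 V1 V2 R1 R2.
  have T : b ^ d1 + (b ^ d2 + (5 * v2 + 1)) + (v1 + v2) <= b ^ d.
    by rewrite /d; powers; apply: leqnn.
  split; first by apply: leq_trans T; lia.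
  move=> env t s lt1t Hr; apply: (runs_in_weaken (leq_trans (leq_addr _ _) T)).
  have := Hr => -[Hin Hsz Henv Hfree].
  apply: runs_in_seq (R1 _ _ _ lt1t Hr) _.
  apply: runs_in_seq (R2 _ _ _ _ (ready_upd _ lt1t (leqnn t) Hr)) _; first by lia.
  set s2 := upd _ _ _.
  have ne : t.+1 != t by apply/eqP; lia.
  have := @runs_in_Move t.+1 t s2 ne.
  have -> : s2 t.+1 = nseq v2 true by rewrite /s2 upd_same.
  rewrite size_nseq; move/runs_in_eq; apply.
  apply: functional_extensionality => q; rewrite /s2 !updE.
  rewrite eqxx [t == _]eq_sym (negbTE ne).
  have [_|_] := eqVneq q t; first by rewrite catrev_nseq addnC.
  by have [->|] := eqVneq q t.+1; rewrite ?(Hfree _ (leqnSn t)).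
- evar (d : nat); exists d => x u r; have b1 := weight_gt1 x u r.
  have [V1 R1] := IH1 x u r; have [V2 R2] := IH2 x u r.
  rewrite [eval _ _ _ (ESub _ _)]/=.
  move: (eval x u r e) (eval x u r e') V1 V2 R1 R2.
  move: (weight x u r) b1 => b b1 v1 v2 V1 V2 R1 R2.
  have T : b ^ d1 + (b ^ d2 + (3 * v2 + 1)) + v1 <= b ^ d.
    by rewrite /d; powers; apply: leqnn.
  split; first by apply: leq_trans T; lia.
  move=> env t s lt1t Hr; apply: (runs_in_weaken (leq_trans (leq_addr _ _) T)).
  have := Hr => -[Hin Hsz Henv Hfree].
  apply: runs_in_seq (R1 _ _ _ lt1t Hr) _.
  apply: runs_in_seq (R2 _ _ _ _ (ready_upd _ lt1t (leqnn t) Hr)) _; first by lia.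
  set s2 := upd _ _ _.
  have ne : t.+1 != t by apply/eqP; lia.
  have := @runs_in_Drop t.+1 t s2 ne.
  have -> : s2 t.+1 = nseq v2 true by rewrite /s2 upd_same.
  rewrite size_nseq; move/runs_in_eq; apply.
  apply: functional_extensionality => q; rewrite /s2 !updE.
  rewrite eqxx [t == _]eq_sym (negbTE ne).
  have [_|_] := eqVneq q t; first by rewrite drop_nseq.
  by have [->|] := eqVneq q t.+1; rewrite ?(Hfree _ (leqnSn t)).
- evar (d : nat); exists d => x u r; have b1 := weight_gt1 x u r.
  have [V1 R1] := IH1 x u r; rewrite [eval _ _ _ (ESum _ _)]/=.
  set v1 := eval x u r e in V1 R1 *.
  pose F i := eval x u (i :: r) e'.
  (* The index enlarges the weight at most to a fixed power, so the exponent of the body is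
     multiplied by a constant. *)
  have Wi i : i < v1 -> weight x u (i :: r) <= weight x u r ^ (1 + d1).+1.
    move=> lt_i; apply: (@leq_trans (weight x u r + v1)).
      by rewrite /weight /=; lia.
    by apply: leq_pow_add => //; rewrite expn1.
  have {}IH2 i : i < v1 ->
      F i <= weight x u r ^ ((1 + d1).+1 * d2) /\
      forall env t s, 1 < t -> ready x u (i :: r) env t s ->
      runs_in (compile env t e') s (weight x u r ^ ((1 + d1).+1 * d2))
      (upd s t (nseq (F i) true)).
    move=> lt_i; have [V2 R2] := IH2 x u (i :: r).
    have le_i := leq_pow_exp d2 (Wi i lt_i).
    split; first exact: leq_trans V2 le_i.
    by move=> env t s lt1t Hr; apply: runs_in_weaken le_i _; apply: R2.
  have -> : \sum_(i < v1) eval x u (val i :: r) e' = \sum_(i < v1) F i by [].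
  move: (weight x u r) b1 V1 R1 IH2 {Wi} => b b1 V1 R1.
  set B := b ^ _; move=> IH2.
  have SF : \sum_(i < v1) F i <= v1 * B by apply: sum_leq => i /IH2[].
  have HB : B <= b ^ ((1 + d1).+1 * d2) by [].
  have T : b ^ d1 + (v1 * ((1 + (B + ((5 * B + 1) + 2))) + 1) + 1 + (2 * v1 + 1)) + v1 * B <= b ^ d.
    by rewrite /d; powers; apply: leqnn.
  split; first by apply: leq_trans T; apply: leq_trans SF _; apply: leq_addl.
  move=> env t s lt1t Hr; apply: (runs_in_weaken (leq_trans (leq_addr _ _) T)).
  have := Hr => -[Hin Hsz Henv Hfree].
  have [s_0 s_1 s_2 s_3] : [/\ s t = [::], s t.+1 = [::], s t.+2 = [::] & s t.+3 = [::]].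
    by split; apply: Hfree; lia.
  have Hr1 := ready_weaken (leqnSn t) Hr.
  have /= R := R1 _ t.+1 _ (ltnW lt1t) Hr1; apply: runs_in_seq R _.
  (* Register [t.+1] counts the remaining rounds, [t.+2] holds the index and [t] the partial sum. *)
  pose f i := upd (upd (upd s t.+1 (nseq (v1 - i) true)) t.+2 (nseq i true))
                t (nseq (\sum_(j < i) F j) true).
  apply: (runs_in_seq (s2 := f v1)); last first.
    have := @runs_in_Clear t.+2 (f v1).
    have -> : f v1 t.+2 = nseq v1 true.
      by rewrite /f !updE !succ_neq eqxx.
    rewrite size_nseq => /runs_in_eq; apply.
    apply: functional_extensionality => q; rewrite /f !updE subnn /=.
    have [->|n1] := eqVneq q t.+2; first by rewrite !succ_neq s_2.
    have [_|n2] := eqVneq q t => //.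
    by have [->|n3] := eqVneq q t.+1; rewrite ?s_1.
  have f0 : f 0 = upd s t.+1 (nseq v1 true).
    apply: functional_extensionality => q; rewrite /f !updE subn0 big_ord0 /=.
    have [->|n2] := eqVneq q t; first by rewrite !succ_neq s_0.
    by have [->|n3] := eqVneq q t.+2; rewrite // !succ_neq s_2.
  rewrite -f0; apply: runs_in_while; last first.
    by rewrite /f !updE !succ_neq eqxx subnn.
  move=> i lt_i.
  have ft1 : f i t.+1 = nseq (v1 - i) true.
    by rewrite /f !updE !succ_neq eqxx.
  split; first by rewrite ft1; case: (v1 - i) (subn_gt0 i v1) => //; rewrite lt_i.
  apply: runs_in_seq (runs_in_pop _ _) _; rewrite ft1.
  set s1 := upd _ _ _.
  have [Vi /(_ (t.+2 :: env) t.+3 s1) Ri] := IH2 i lt_i.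
  apply: (runs_in_seq (Ri _ _)); first by lia.
    split=> [w|/=|[|j] lt_j|q lt_q] /=.
    - by rewrite /s1 /f !updE !ifN ?Hin //; apply/eqP; case: (w); lia.
    - by rewrite Hsz.
    - split; first by lia.
      by rewrite /s1 /f !updE eqxx !succ_neq.
    - have [Hj E] := Henv j lt_j; split; first by lia.
      by rewrite /s1 /f !updE !ifN ?E //; apply/eqP; lia.
    - by rewrite /s1 /f !updE !ifN ?Hfree //; try (apply/eqP); lia.
  set s2 := upd s1 _ _.
  apply: (runs_in_seq (s2 := upd (upd s2 t.+3 [::]) t (nseq (\sum_(j < i.+1) F j) true))).
    have ne : t.+3 != t by apply/eqP; lia.
    have := runs_in_Move s2 ne.
    have -> : s2 t.+3 = nseq (F i) true by rewrite /s2 upd_same.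
    have -> : s2 t = nseq (\sum_(j < i) F j) true.
      by rewrite /s2 /s1 /f !updE eqxx !succ_neq.
    rewrite size_nseq catrev_nseq big_ord_recr /= (addnC (F i)) => H.
    apply: runs_in_weaken _ H; lia.
  apply: (runs_in_eq (runs_in_push _ _ _)).
  apply: functional_extensionality => q; rewrite /s2 /s1 /f !updE eqxx.
  rewrite !succ_neq.
  have [->|n1] := eqVneq q t.+2; first by rewrite !succ_neq.
  have [_|n2] := eqVneq q t => //.
  have [->|n3] := eqVneq q t.+3; first by rewrite !succ_neq s_3.
  have [_|n4] := eqVneq q t.+1 => //.
  by rewrite -drop1 drop_nseq; congr nseq; lia.
- evar (d : nat); exists d => x u r; have b1 := weight_gt1 x u r.
  have [V1 R1] := IH1 x u r; rewrite [eval _ _ _ (EBit _ _)]/=.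
  move: (eval x u r e) (weight x u r) b1 V1 R1 => v b b1 V1 R1.
  have T : b ^ d1 + (12 * v + 5) <= b ^ d by rewrite /d; powers; apply: leqnn.
  split; first by apply: leq_trans T; case: (nth _ _ _) => /=; lia.
  move=> env t s lt1t Hr; apply: (runs_in_weaken T).
  have := Hr => -[Hin Hsz Henv Hfree].
  have Hr1 := ready_weaken (leqnSn t) Hr.
  have /= R := R1 _ t.+1 _ (ltnW lt1t) Hr1; apply: runs_in_seq R _.
  set s1 := upd _ _ _.
  have uq : uniq [:: t.+1; nat_of_bool w; t; t.+2].
    by rewrite /= !inE; case: (w) => /=; lia.
  have s1p : s1 t.+2 = [::] by rewrite /s1 upd_other ?Hfree //; apply/eqP; lia.
  have s1t : s1 t.+1 = nseq v true by rewrite /s1 upd_same.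
  have s1w : s1 w = input x u w.
    by rewrite /s1 upd_other ?Hin //; apply/eqP; case: (w); lia.
  have s1t0 : s1 t = [::] by rewrite /s1 upd_other ?Hfree //; apply/eqP; lia.
  have := runs_in_FetchBit uq s1p; rewrite s1t s1w s1t0 size_nseq cats0.
  move/runs_in_eq; apply; apply: functional_extensionality => q.
  rewrite /s1 !updE; have [_|n1] := eqVneq q t => //.
  by have [->|n4] := eqVneq q t.+1 => //; rewrite Hfree.
- evar (d : nat); exists d => x u r; have b1 := weight_gt1 x u r.
  have le_b : size (input x u w) <= weight x u r ^ 1.
    by rewrite expn1 /weight /input; case: w; lia.
  move: (weight x u r) b1 le_b => b b1 le_b.
  have T : 12 * size (input x u w) + 2 <= b ^ d by rewrite /d; powers.
  split; first by apply: leq_trans T => /=; lia.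
  move=> env t s lt1t [Hin Hsz Henv Hfree] /=; apply: runs_in_weaken T _.
  have := @runs_in_Measure w t t.+1 s.
  rewrite Hin (Hfree t) // cats0; apply; try (by apply/eqP; case: (w); lia).
  exact: Hfree.
Qed.

(** * Renaming and substitution in terms *)

Fixpoint rename (f : nat -> nat) (e : expr) : expr :=
  match e with
  | EVar i => EVar (f i)
  | EOne => EOne
  | EAdd e e' => EAdd (rename f e) (rename f e')
  | ESub e e' => ESub (rename f e) (rename f e')
  | ESum e e' => ESum (rename f e) (rename (fun i => if i is j.+1 then (f j).+1 else 0) e')
  | EBit w e => EBit w (rename f e)
  | ESize w => ESize w
  end.

Lemma eval_rename x u f e r r' : (forall i, nth 0 r (f i) = nth 0 r' i) ->
  eval x u r (rename f e) = eval x u r' e.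
Proof.
elim: e f r r' => //= [e IH e' IH'|e IH e' IH'|e IH e' IH'|w e IH] f r r' Hf.
- by rewrite (IH _ _ _ Hf) (IH' _ _ _ Hf).
- by rewrite (IH _ _ _ Hf) (IH' _ _ _ Hf).
- rewrite (IH _ _ _ Hf); apply: eq_bigr => i _; apply: IH'.
  by case=> [|j] /=.
- by rewrite (IH _ _ _ Hf).
Qed.

Fixpoint subst (f : nat -> expr) (e : expr) : expr :=
  match e with
  | EVar i => f i
  | EOne => EOne
  | EAdd e e' => EAdd (subst f e) (subst f e')
  | ESub e e' => ESub (subst f e) (subst f e')
  | ESum e e' =>
      ESum (subst f e)
        (subst (fun i => if i is j.+1 then rename succn (f j) else EVar 0) e')
  | EBit w e => EBit w (subst f e)
  | ESize w => ESize w
  end.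

Lemma eval_subst x u f e r r' : (forall i, eval x u r (f i) = nth 0 r' i) ->
  eval x u r (subst f e) = eval x u r' e.
Proof.
elim: e f r r' => //= [e IH e' IH'|e IH e' IH'|e IH e' IH'|w e IH] f r r' Hf.
- by rewrite (IH _ _ _ Hf) (IH' _ _ _ Hf).
- by rewrite (IH _ _ _ Hf) (IH' _ _ _ Hf).
- rewrite (IH _ _ _ Hf); apply: eq_bigr => i _; apply: IH'.
  case=> [|j] //=; rewrite -Hf; exact: eval_rename.
- by rewrite (IH _ _ _ Hf).
Qed.

(* [r] is an environment of de Bruijn indices: under a binder, the new variable
   is [head 0 r] and the old environment is [behead r]. *)
Definition PF (F : word -> word -> seq nat -> nat) : Prop :=
  exists e, forall x u r, eval x u r e = F x u r.

Definition PB (B : word -> word -> seq nat -> bool) : Prop :=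
  PF (fun x u r => nat_of_bool (B x u r)).

(** * Closure properties of functions given by terms *)

Lemma PF_ext F G : (forall x u r, F x u r = G x u r) -> PF F -> PF G.
Proof. by move=> E [e He]; exists e => x u r; rewrite He. Qed.

Lemma PB_ext B C : (forall x u r, B x u r = C x u r) -> PB B -> PB C.
Proof. by move=> E [e He]; exists e => x u r; rewrite He E. Qed.

Lemma PF_skip n F : PF F -> PF (fun x u r => F x u (iter n behead r)).
Proof.
case=> e He; exists (rename (addn n) e) => x u r.
rewrite -He; apply: eval_rename => i.
by elim: n r => [|n IH] r //; rewrite iterSr -IH addSn nth_behead.
Qed.

(** Substitution for the innermost variable; [iter n behead] forgets [n] binders, whose variables
    the argument may still use. *)
Lemma PF_app1 n F A : PF F -> PF A ->
  PF (fun x u r => F x u (A x u r :: iter n behead r)).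
Proof.
move=> [e He] [a Ha].
exists (subst (fun i => if i is j.+1 then EVar (n + j) else a) e) => x u r.
rewrite -He; apply: eval_subst => -[|i] //=.
by elim: n r => [|n IH] r //; rewrite iterSr -IH addSn nth_behead.
Qed.

Lemma PF_app2 n F A B : PF F -> PF A -> PF B ->
  PF (fun x u r => F x u (A x u r :: B x u r :: iter n behead r)).
Proof.
move=> [e He] [a Ha] [b Hb].
exists (subst (fun i => match i with 0 => a | 1 => b | j.+2 => EVar (n + j) end) e)
  => x u r.
rewrite -He; apply: eval_subst => -[|[|i]] //=.
by elim: n r => [|n IH] r //; rewrite iterSr -IH addSn nth_behead.
Qed.

Lemma PF_head : PF (fun x u r => head 0 r).
Proof. by exists (EVar 0) => x u [|]. Qed.

Lemma PF_const c : PF (fun x u r => c).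
Proof.
elim: c => [|c [e He]]; first by exists (ESub EOne EOne).
by exists (EAdd EOne e) => x u r; rewrite /= He.
Qed.

Lemma PF_add F G : PF F -> PF G -> PF (fun x u r => F x u r + G x u r).
Proof. by move=> [e He] [f Hf]; exists (EAdd e f) => x u r; rewrite /= He Hf. Qed.

Lemma PF_succ F : PF F -> PF (fun x u r => (F x u r).+1).
Proof. exact: PF_add (PF_const 1). Qed.

Lemma PF_sub F G : PF F -> PF G -> PF (fun x u r => F x u r - G x u r).
Proof. by move=> [e He] [f Hf]; exists (ESub e f) => x u r; rewrite /= He Hf. Qed.

Lemma PF_sum F G : PF F -> PF (fun x u r => G x u (behead r) (head 0 r)) ->
  PF (fun x u r => \sum_(i < F x u r) G x u r i).
Proof.
move=> [e He] [f Hf]; exists (ESum e f) => x u r; rewrite /= He.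
by under eq_bigr do rewrite Hf.
Qed.

Lemma PF_mul F G : PF F -> PF G -> PF (fun x u r => F x u r * G x u r).
Proof.
move=> HF HG; have := @PF_sum F (fun x u r _ => G x u r) HF (PF_skip 1 HG).
by apply: PF_ext => x u r; rewrite sum_nat_const card_ord.
Qed.

Lemma PF_size_x : PF (fun x u r => size x). Proof. by exists (ESize false). Qed.

Lemma PF_size_u : PF (fun x u r => size u). Proof. by exists (ESize true). Qed.

Lemma PB_bit_x F : PF F -> PB (fun x u r => nth false x (F x u r)).
Proof. by move=> [e He]; exists (EBit false e) => x u r; rewrite /= He. Qed.

Lemma PB_bit_u F : PF F -> PB (fun x u r => nth false u (F x u r)).
Proof. by move=> [e He]; exists (EBit true e) => x u r; rewrite /= He. Qed.

Lemma PB_const b : PB (fun x u r => b). Proof. exact: PF_const. Qed.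

(** With truncated subtraction, [1 - n] tests whether [n] is 0. *)
Lemma PB_leq F G : PF F -> PF G -> PB (fun x u r => F x u r <= G x u r).
Proof.
move=> HF HG; apply: PF_ext (PF_sub (PF_const 1) (PF_sub HF HG)) => x u r.
by rewrite /leq; case: (_ - G x u r).
Qed.

Lemma PB_neg B : PB B -> PB (fun x u r => ~~ B x u r).
Proof. by move=> HB; apply: PF_ext (PF_sub (PF_const 1) HB) => x u r; case: (B x u r). Qed.

Lemma PB_and B C : PB B -> PB C -> PB (fun x u r => B x u r && C x u r).
Proof.
move=> HB HC; apply: PF_ext (PF_mul HB HC) => x u r.
by case: (B x u r); case: (C x u r).
Qed.

Lemma PB_or B C : PB B -> PB C -> PB (fun x u r => B x u r || C x u r).
Proof.
move=> HB HC; apply: PB_ext (PB_neg (PB_and (PB_neg HB) (PB_neg HC))) => x u r.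
by rewrite negb_and !negbK.
Qed.

Lemma PB_imp B C : PB B -> PB C -> PB (fun x u r => B x u r ==> C x u r).
Proof. by move=> HB HC; apply: PB_ext (PB_or (PB_neg HB) HC) => x u r; rewrite implybE. Qed.

Lemma PB_eqn F G : PF F -> PF G -> PB (fun x u r => F x u r == G x u r).
Proof.
move=> HF HG; apply: PB_ext (PB_and (PB_leq HF HG) (PB_leq HG HF)) => x u r.
by rewrite eqn_leq.
Qed.

Lemma PB_eqb B C : PB B -> PB C -> PB (fun x u r => B x u r == C x u r).
Proof.
move=> HB HC; apply: PB_ext (PB_eqn HB HC) => x u r.
by case: (B x u r); case: (C x u r).
Qed.

Lemma PF_ifn B F G : PB B -> PF F -> PF G ->
  PF (fun x u r => if B x u r then F x u r else G x u r).
Proof.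
move=> HB HF HG; apply: PF_ext (PF_add (PF_mul HB HF) (PF_mul (PB_neg HB) HG)).
by move=> x u r; case: (B x u r); rewrite ?mul1n ?mul0n ?addn0.
Qed.

Lemma PB_if B C D : PB B -> PB C -> PB D ->
  PB (fun x u r => if B x u r then C x u r else D x u r).
Proof.
move=> HB HC HD; apply: PF_ext (PF_ifn HB HC HD).
by move=> x u r; case: (B x u r).
Qed.

(** A bounded sum counts the counterexamples. *)
Lemma PB_all F B : PF F -> PB (fun x u r => B x u (behead r) (head 0 r)) ->
  PB (fun x u r => all (fun i => B x u r i) (iota 0 (F x u r))).
Proof.
move=> HF HB.
have HS := @PF_sum F (fun x u r i => nat_of_bool (~~ B x u r i)) HF (PB_neg HB).
apply: PB_ext (PB_eqn HS (PF_const 0)) => x u r.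
rewrite sum_nat_eq0; apply/idP/allP => [/forallP H i|H].
  rewrite mem_iota => /andP[_ lt_i].
  by have := H (Ordinal lt_i); rewrite eqb0 negbK.
by apply/forallP => i; rewrite eqb0 negbK H // mem_iota /=.
Qed.

Lemma PB_has F B : PF F -> PB (fun x u r => B x u (behead r) (head 0 r)) ->
  PB (fun x u r => has (fun i => B x u r i) (iota 0 (F x u r))).
Proof.
move=> HF HB.
have H := @PB_all F (fun x u r i => ~~ B x u r i) HF (PB_neg HB).
by apply: PB_ext (PB_neg H) => x u r; rewrite -has_predC; apply: eq_has => i /=; rewrite negbK.
Qed.

Lemma sum_ltn n m : m <= n -> \sum_(i < n) (i < m) = m.
Proof.
move=> le_mn; rewrite -(subnKC le_mn) big_split_ord /=.
rewrite [X in _ + X]big1 => [|i _]; last by rewrite ltnNge leq_addr.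
rewrite addn0 (eq_bigr (fun=> 1)) => [|i _]; last by rewrite ltn_ord.
by rewrite sum1_card card_ord.
Qed.

(** The quotient of [f] by [g] is the number of [i < f] with [i.+1 * g <= f]; the test [0 < g] gives
    0 for divisor 0. *)
Lemma PF_div F G : PF F -> PF G -> PF (fun x u r => F x u r %/ G x u r).
Proof.
move=> HF HG.
have H : PB (fun x u r => (0 < G x u (behead r)) &&
    ((head 0 r).+1 * G x u (behead r) <= F x u (behead r))).
  apply: PB_and; first exact: PB_leq (PF_const 1) (PF_skip 1 HG).
  exact: PB_leq (PF_mul (PF_succ PF_head) (PF_skip 1 HG)) (PF_skip 1 HF).
have := @PF_sum F (fun x u r i =>
  nat_of_bool ((0 < G x u r) && (i.+1 * G x u r <= F x u r))) HF H.
apply: PF_ext => x u r; case: (G x u r) => [|g] /=.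
  by rewrite divn0 big1.
move: (F x u r) => f; under eq_bigr => i _ do rewrite -leq_divRL //.
by apply: sum_ltn; apply: leq_div.
Qed.

Lemma PF_mod F G : PF F -> PF G -> PF (fun x u r => F x u r %% G x u r).
Proof.
move=> HF HG; apply: PF_ext (PF_sub HF (PF_mul (PF_div HF HG) HG)) => x u r.
by rewrite {1}(divn_eq (F x u r) (G x u r)) addKn.
Qed.

Lemma PB_odd F : PF F -> PB (fun x u r => odd (F x u r)).
Proof. by move=> HF; apply: PF_ext (PF_mod HF (PF_const 2)) => x u r; rewrite modn2. Qed.

Lemma PF_exp F n : PF F -> PF (fun x u r => F x u r ^ n).
Proof.
move=> HF; elim: n => [|n IH]; first exact: PF_const 1.
by apply: PF_ext (PF_mul HF IH) => x u r; rewrite expnS.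
Qed.

Lemma PF_horner (p : {poly nat}) F : PF F -> PF (fun x u r => p.[F x u r]%R).
Proof.
move=> HF; elim/poly_ind: p => [|p c IH].
  by apply: PF_ext (PF_const 0) => x u r; rewrite hornerC.
apply: PF_ext (PF_add (PF_mul IH HF) (PF_const c)) => x u r.
by rewrite hornerMXaddC.
Qed.

(** A finite table is wired into the term by nested conditionals, so [g] may be arbitrary. *)
Lemma PF_table n (g : nat -> nat) F : PF F ->
  PF (fun x u r => if F x u r < n then g (F x u r) else 0).
Proof.
move=> HF; elim: n => [|n IH]; first exact: PF_const 0.
apply: PF_ext (PF_ifn (PB_eqn HF (PF_const n)) (PF_const (g n)) IH) => x u r.
by rewrite ltnS [F x u r <= n]leq_eqVlt; have [->|] := eqVneq (F x u r) n.
Qed.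

Lemma PB_table n (g : nat -> bool) F : PF F ->
  PB (fun x u r => (F x u r < n) && g (F x u r)).
Proof.
move=> HF; apply: PF_ext (PF_table n (fun i => nat_of_bool (g i)) HF) => x u r.
by case: ifP.
Qed.

Lemma PB_all_seq (T : Type) (s : seq T) (B : T -> word -> word -> seq nat -> bool) :
  (forall t, PB (B t)) -> PB (fun x u r => all (fun t => B t x u r) s).
Proof.
move=> HB; elim: s => [|t s IH]; first exact: PB_const true.
exact: PB_and (HB t) IH.
Qed.

(** Terms have numbers as values, so a word is given by its length and its bits. *)
Definition PW (W : word -> word -> seq nat -> word) : Prop :=
  PF (fun x u r => size (W x u r)) /\
  PB (fun x u r => nth false (W x u (behead r)) (head 0 r)).

Lemma PW_ext V W : (forall x u r, V x u r = W x u r) -> PW V -> PW W.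
Proof.
move=> E [HS HB]; split; first by apply: PF_ext HS => x u r; rewrite E.
by apply: PB_ext HB => x u r; rewrite E.
Qed.

Lemma PW_skip n W : PW W -> PW (fun x u r => W x u (iter n behead r)).
Proof.
move=> [HS HB]; split; first exact: (PF_skip n HS).
have := @PF_app1 n.+1 _ _ HB PF_head; apply: PF_ext => x u r /=.
by rewrite -iterS iterSr.
Qed.

Lemma PB_nth W F : PW W -> PF F ->
  PB (fun x u r => nth false (W x u r) (F x u r)).
Proof. by case=> _ HB HF; have := @PF_app1 0 _ _ HB HF. Qed.

Lemma PW_mkseq F B : PF F -> PB (fun x u r => B x u (behead r) (head 0 r)) ->
  PW (fun x u r => [seq B x u r i | i <- iota 0 (F x u r)]).
Proof.
move=> HF HB; split.
  by apply: PF_ext HF => x u r; rewrite size_map size_iota.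
apply: PB_ext (PB_and (PB_leq (PF_succ PF_head) (PF_skip 1 HF)) HB) => x u r /=.
have [lt_i|le_i] := ltnP; last by rewrite nth_default // size_map size_iota.
by rewrite (nth_map 0) ?size_iota // nth_iota.
Qed.

Lemma PW_const w : PW (fun x u r => w).
Proof.
split; first exact: PF_const.
apply: PB_ext (PB_table (size w) (nth false w) PF_head) => x u r.
by case: ltnP => //= le_i; rewrite nth_default.
Qed.

Lemma PW_nseq F b : PF F -> PW (fun x u r => nseq (F x u r) b).
Proof.
move=> HF; apply: PW_ext (PW_mkseq (B := fun _ _ _ _ => b) HF (PB_const b)) => x u r.
by elim: (F x u r) 0 => //= n IH m; rewrite IH.
Qed.

Lemma PW_cat V W : PW V -> PW W -> PW (fun x u r => V x u r ++ W x u r).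
Proof.
move=> HV HW; have [SV _] := HV; have [SW _] := HW; split.
  by apply: PF_ext (PF_add SV SW) => x u r; rewrite size_cat.
have := PB_if (PB_leq (PF_succ PF_head) (PF_skip 1 SV))
  (PB_nth (PW_skip 1 HV) PF_head)
  (PB_nth (PW_skip 1 HW) (PF_sub PF_head (PF_skip 1 SV))).
by apply: PB_ext => x u r; rewrite /= nth_cat.
Qed.

Lemma size_flatten_iota (W : nat -> word) n :
  size (flatten [seq W i | i <- iota 0 n]) = \sum_(i < n) size (W i).
Proof.
rewrite size_flatten /shape -map_comp sumnE big_map.
by rewrite -(big_mkord xpredT (fun i => size (W i))) /index_iota subn0.
Qed.

(** The position need not be located in its block: a block that ends before [p] contributes the
    default [false], so one can ask whether any block has a true bit there. *)
Lemma nth_flatten_iota (W : nat -> word) n p :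
  nth false (flatten [seq W i | i <- iota 0 n]) p =
  has (fun i => let o := \sum_(j < i) size (W j) in
         (o <= p) && nth false (W i) (p - o)) (iota 0 n).
Proof.
elim: n => [|n IH]; first by rewrite nth_nil.
rewrite -addn1 iotaD map_cat flatten_cat has_cat /= cats0 orbF add0n nth_cat IH.
rewrite size_flatten_iota.
set o := \sum_(j < n) _; case: ltnP => [lt_p|le_p]; first by rewrite orbF.
rewrite [has _ _]negbTE //; apply/hasPn => i; rewrite mem_iota add0n => /andP[_ lt_i].
rewrite negb_and; apply/orP; right; rewrite nth_default // leq_subRL.
  apply: leq_trans le_p; rewrite /o -(subnKC lt_i) big_split_ord /=.
  by rewrite big_ord_recr /= leq_addr.
apply: leq_trans le_p; rewrite /o -(subnKC (ltnW lt_i)) big_split_ord /=.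
exact: leq_addr.
Qed.

Lemma PW_flatten F W : PF F -> PW (fun x u r => W x u (behead r) (head 0 r)) ->
  PW (fun x u r => flatten [seq W x u r i | i <- iota 0 (F x u r)]).
Proof.
move=> HF HW; have [SW _] := HW; split.
  apply: PF_ext (PF_sum (G := fun x u r i => size (W x u r i)) HF SW) => x u r.
  by rewrite size_flatten_iota.
have So : PF (fun x u r => \sum_(j < head 0 r) size (W x u (behead (behead r)) j)).
  apply: (PF_sum (G := fun x u r j => size (W x u (behead (behead r)) j))).
    exact: PF_head.
  exact: (PF_app1 3 SW PF_head).
have Hp : PF (fun x u r => head 0 (behead r)) := PF_skip 1 PF_head.
have [_ BW] := HW.
have Hn : PB (fun x u r => nth false (W x u (behead (behead r)) (head 0 r))
   (head 0 (behead r) - \sum_(j < head 0 r) size (W x u (behead (behead r)) j))).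
  exact: (@PF_app2 2 _ _ _ BW (PF_sub Hp So) PF_head).
have := @PB_has (fun x u r => F x u (behead r)) (fun x u r i =>
   (\sum_(j < i) size (W x u (behead r) j) <= head 0 r) &&
     nth false (W x u (behead r) i)
       (head 0 r - \sum_(j < i) size (W x u (behead r) j)))
  (PF_skip 1 HF) (PB_and (PB_leq So Hp) Hn).
by apply: PB_ext => x u r; rewrite nth_flatten_iota.
Qed.

Lemma PB_eqw V W : PW V -> PW W -> PB (fun x u r => V x u r == W x u r).
Proof.
move=> HV HW; have [SV BV] := HV; have [SW BW] := HW.
have H := @PB_all _ (fun x u r i => nth false (V x u r) i == nth false (W x u r) i)
  SV (PB_eqb BV BW).
apply: PB_ext (PB_and (PB_eqn SV SW) H) => x u r.
apply/andP/eqP => [[/eqP E /allP Hall]|->]; last by split=> //; apply/allP.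
apply: (eq_from_nth E) => i lt_i; apply/eqP/Hall.
by rewrite mem_iota.
Qed.

(** * From terms to polynomial-time machines *)

Lemma ready_input x u : ready x u [::] [::] 2 (input_state x u).
Proof.
split=> //; first by case.
by case=> [|[|q]] //; rewrite /input_state /= nth_nil.
Qed.

Definition WriteBit (i o : nat) : cmd := If false i (Push o true) (Push o false).

Lemma runs_in_WriteBit i o n s : s i = nseq n true ->
  runs_in (WriteBit i o) s 3 (upd s o ((0 < n) :: s o)).
Proof.
move=> si; apply: (runs_in_if (t := 2)); rewrite si /=.
by case: n {si} => [|n]; apply: runs_in_push.
Qed.

Lemma horner_bound d x u :
  weight x u [::] ^ d = (('X + 2%:P) ^+ d : {poly nat}).[(size x + size u)%N]%R.
Proof.
have pw a n : (a ^+ n)%R = a ^ n by elim: n => // n IH; rewrite exprS IH expnS.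
rewrite horner_exp !hornerE pw /weight /= addn0.
by rewrite -[2]/(1 + 1) addnA.
Qed.

Lemma polytime_pred2_of v : PB (fun x u r => v x u) -> polytime_pred2 v.
Proof.
case=> e He; have [d Hd] := compile_poly e.
(* The input has to be erased, since the output extends to the first non-bit of tape 0. *)
have [M HM] := run_returns_within (Seq (compile [::] 2 e) (Seq (Clear 0) (WriteBit 2 0))).
evar (d' : nat); exists M, (('X + 2%:P) ^+ d')%R => x u.
have [_ /(_ [::] 2 _ isT (ready_input x u)) H] := Hd x u [::].
set s1 := upd _ _ _ in H.
have s1_0 : s1 0 = x by [].
have [k le_k Hk] := runs_in_seq H (runs_in_seq (runs_in_Clear 0 s1)
  (runs_in_WriteBit (i := 2) 0 (n := v x u) (s := upd s1 0 [::]) ltac:(by rewrite /s1 /= /upd /= He))).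
have -> : [:: v x u] = upd (upd s1 0 [::]) 0 ((0 < v x u) :: upd s1 0 [::] 0) 0.
  by rewrite !upd_same; case: (v x u).
apply: (HM) Hk; apply: leq_trans le_k _; rewrite -horner_bound s1_0.
have b1 := weight_gt1 x u [::].
have le_x : size x <= weight x u [::] ^ 1 by rewrite expn1 /weight; lia.
move: (weight x u [::]) b1 le_x => b b1 le_x.
by rewrite /d'; powers; apply: leqnn.
Qed.

Lemma polytime_of f : PW (fun x u r => f x) -> polytime f.
Proof.
case=> [[L HL] [B HB]].
have [d1 Hd1] := compile_poly L; have [d2 Hd2] := compile_poly B.
pose body := Seq (Pop 2) (Seq (compile [:: 3] 5 B)
  (Seq (WriteBit 5 4) (Seq (Clear 5) (Push 3 true)))).
have [M HM] := run_returns_within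
  (Seq (compile [::] 2 L) (Seq (While 2 body) (Seq (Clear 0) (Move 4 0)))).
evar (d : nat).
exists M, (('X + 2%:P) ^+ d)%R => x.
have [] := Hd1 x [::] [::]; rewrite HL => V1 /(_ [::] 2 _ isT (ready_input x [::])) H1.
have Ed := horner_bound d x [::]; rewrite /= addn0 in Ed.
have lt_x : size x <= weight x [::] [::] ^ 1 by rewrite expn1 /weight; lia.
move: (weight_gt1 x [::] [::]) Ed V1 H1 lt_x.
have Wi i : i < size (f x) -> weight x [::] [:: i] <= weight x [::] [::] + size (f x).
  by rewrite /weight /=; lia.
move: Wi; move: (weight x [::] [::]) => b Wi b1 Ed V1 H1 lt_x.
have {}Wi i : i < size (f x) -> weight x [::] [:: i] <= b ^ (1 + d1).+1.
  by move=> /Wi H; apply: leq_trans H _; apply: leq_pow_add => //; rewrite expn1.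
set n := size (f x) in V1 H1 Wi.
pose T := b ^ ((1 + d1).+1 * d2).
pose s0 := input_state x [::].
pose g i := upd (upd (upd s0 2 (nseq (n - i) true)) 3 (nseq i true)) 4
   (rev (take i (f x))).
have Hbody i : i < n -> g i 2 <> [::] /\
    runs_in body (g i) (1 + (T + (3 + (2 * 1 + 1 + 2)))) (g i.+1).
  move=> lt_i; have g2 : g i 2 = nseq (n - i) true by [].
  split; first by rewrite g2; case: (n - i) (subn_gt0 i n) => //; rewrite lt_i.
  apply: runs_in_seq (runs_in_pop _ _) _; set s1 := upd _ _ _.
  have [_ /(_ [:: 3] 5 s1 isT) H2] := Hd2 x [::] [:: i].
  have ready1 : ready x [::] [:: i] [:: 3] 5 s1.
    split=> //; [by case|by case|].
    by case=> [|[|[|[|[|q]]]]] //; rewrite /s1 /g /s0 /input_state /upd /= nth_nil.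
  have {}H2 := runs_in_weaken (leq_pow_exp d2 (Wi i lt_i)) (H2 ready1).
  apply: runs_in_seq H2 _; rewrite HB; set s2 := upd _ _ _.
  apply: (runs_in_seq (runs_in_WriteBit (i := 5) 4 (n := nth false (f x) i) _)).
    by rewrite /s2 upd_same.
  set s3 := upd _ _ _.
  apply: (runs_in_seq (s2 := upd s3 5 [::])).
    apply: runs_in_weaken (runs_in_Clear 5 s3).
    have -> : s3 5 = nseq (nth false (f x) i) true by [].
    by rewrite size_nseq; case: (nth _ _ _).
  apply: (runs_in_eq (runs_in_push _ _ _)).
  apply: functional_extensionality => q.
  rewrite /s3 /s2 /s1 /g (take_nth false) // rev_rcons /s0.
  case: q => [|[|[|[|[|[|q]]]]]] //=.
    by rewrite !updE /= -drop1 drop_nseq; congr nseq; lia.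
  by rewrite !updE /=; case: (nth _ _ _).
have g0 : g 0 = upd s0 2 (nseq n true).
  apply: functional_extensionality => q; rewrite /g take0 subn0 !updE.
  by case: q => [|[|[|[|[|q]]]]].
have gn2 : g n 2 = [::] by rewrite /g !updE /= subnn.
have Hloop := runs_in_while Hbody gn2; rewrite g0 in Hloop.
have gn0 : g n 0 = x by [].
have gn4 : upd (g n) 0 [::] 4 = rev (f x) by rewrite updE /g /= updE /= take_size.
have [k le_k Hk] := runs_in_seq H1 (runs_in_seq Hloop
  (runs_in_seq (runs_in_Clear 0 (g n)) (@runs_in_Move 4 0 (upd (g n) 0 [::]) isT))).
have {1}-> : f x = upd (upd (upd (g n) 0 [::]) 4 [::]) 0
    (catrev (upd (g n) 0 [::] 4) (upd (g n) 0 [::] 0)) 0.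
  by rewrite upd_same gn4 upd_same catrevE revK cats0.
apply: (HM) Hk; rewrite -Ed; apply: leq_trans le_k _.
rewrite gn0 gn4 size_rev -/n.
have HT : T <= b ^ ((1 + d1).+1 * d2) by [].
by rewrite /d; powers; apply: leqnn.
Qed.

(** * Codes of k-posets *)

Lemma all_iotaP n (B : nat -> bool) :
  reflect (forall i, i < n -> B i) (all B (iota 0 n)).
Proof.
apply: (iffP allP) => H i; first by move=> lt_i; apply: H; rewrite mem_iota.
by rewrite mem_iota => /andP[_]; apply: H.
Qed.

Lemma has_iotaP n (B : nat -> bool) :
  reflect (exists2 i, i < n & B i) (has B (iota 0 n)).
Proof.
apply: (iffP hasP) => -[i Hi Bi]; exists i => //; last by rewrite mem_iota.
by rewrite mem_iota in Hi.
Qed.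

Definition poset_code (n : nat) (r : nat -> nat -> bool) (c : nat -> nat) : word :=
  nseq n true ++ [:: false]
  ++ flatten [seq [seq r i j | j <- iota 0 n] | i <- iota 0 n]
  ++ flatten [seq rcons (nseq (c i) true) false | i <- iota 0 n].

Definition poset_data (k n : nat) (r : nat -> nat -> bool) (c : nat -> nat) : bool :=
  [&& all (fun i => r i i && (c i < k)) (iota 0 n),
      all (fun i => all (fun j => r i j && r j i ==> (i == j)) (iota 0 n)) (iota 0 n)
    & all (fun i => all (fun j => all (fun l => r i j && r j l ==> r i l)
        (iota 0 n)) (iota 0 n)) (iota 0 n)].

Lemma poset_dataP k n (r : nat -> nat -> bool) c :
  reflect [/\ forall i, i < n -> r i i, forall i, i < n -> c i < k,
    forall i j, i < n -> j < n -> r i j -> r j i -> i = j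
    & forall i j l, i < n -> j < n -> l < n -> r i j -> r j l -> r i l]
  (poset_data k n r c).
Proof.
apply: (iffP and3P) => [[/all_iotaP H1 /all_iotaP H2 /all_iotaP H3]|[H1 H2 H3 H4]]; split.
- by move=> i /H1/andP[].
- by move=> i /H1/andP[].
- by move=> i j /H2/all_iotaP Hi /Hi/implyP Hj rij rji; apply/eqP/Hj/andP.
- move=> i j l /H3/all_iotaP Hi /Hi/all_iotaP Hj /Hj/implyP Hl rij rjl.
  by apply/Hl/andP.
- by apply/all_iotaP => i lt_i; rewrite H1 ?H2.
- apply/all_iotaP => i ?; apply/all_iotaP => j ?.
  by apply/implyP => /andP[rij rji]; apply/eqP; exact: H3.
- apply/all_iotaP => i ?; apply/all_iotaP => j ?; apply/all_iotaP => l ?.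
  by apply/implyP => /andP[rij rjl]; exact: H4 rij rjl.
Qed.

Definition data_hom (n : nat) (r : nat -> nat -> bool) (c : nat -> nat)
    (n' : nat) (r' : nat -> nat -> bool) (c' : nat -> nat) (h : nat -> nat) : Prop :=
  (forall i, i < n -> h i < n' /\ c i = c' (h i)) /\
  (forall i j, i < n -> j < n -> r i j -> r' (h i) (h j)).

(** [f] numbers the elements. From here on k-posets become data on natural numbers, which terms can
    handle. *)
Definition presents (k : nat) (P : kposet k) n r c (f : P -> nat) : Prop :=
  [/\ kposet_enc P = poset_code n r c, poset_data k n r c,
      injective f /\ (forall i, i < n <-> exists x, f x = i),
      forall x y : P, r (f x) (f y) = (x <= y)%O
    & forall x : P, c (f x) = klabel x].

Lemma kposet_presented k (P : kposet k) : exists n r c f, @presents k P n r c f.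
Proof.
pose f (x : P) := index x (enum {: P}); pose n := #|{: P}|.
(* Expressed by preimages, because an empty [P] offers no default element. *)
pose r i j := [exists x : P, exists y : P, [&& f x == i, f y == j & (x <= y)%O]].
pose c i := if [pick x : P | f x == i] is Some x then nat_of_ord (klabel x) else 0.
have f_inj : injective f.
  by move=> x y; apply: (index_inj x); rewrite mem_enum.
have f_lt x : f x < n by rewrite /n cardE index_mem mem_enum.
have f_surj i : i < n <-> exists x, f x = i.
  split; last by case=> x <-.
  rewrite /n cardE => lt_i; have : exists x0 : P, true.
    by case E: (enum {: P}) lt_i => [|x0 s] //; exists x0.
  case=> x0 _; exists (nth x0 (enum {: P}) i).
  by rewrite /f index_uniq ?enum_uniq.
have rE x y : r (f x) (f y) = (x <= y)%O.
  apply/existsP/idP => [[x' /existsP[y' /and3P[/eqP/f_inj-> /eqP/f_inj->]]]|le_xy] //.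
  by exists x; apply/existsP; exists y; rewrite !eqxx.
have cE x : c (f x) = klabel x.
  rewrite /c; case: pickP => [y /eqP/f_inj-> //|/(_ x)].
  by rewrite eqxx.
have fE : [seq f x | x <- enum {: P}] = iota 0 n.
  apply: (@eq_from_nth _ 0) => [|i]; rewrite size_map -cardE ?size_iota // => lt_i.
  have [x0 _] := (f_surj i).1 lt_i.
  by rewrite nth_iota // (nth_map x0) -?cardE // /f index_uniq ?enum_uniq -?cardE.
exists n, r, c, f; split=> //.
  rewrite /kposet_enc /poset_code -cats1 -!catA -fE; congr (_ ++ _ ++ _ ++ _).
    rewrite -map_comp; congr flatten; apply: eq_map => x /=.
    by rewrite -map_comp; apply: eq_map => y /=; rewrite rE.
  by rewrite -map_comp; congr flatten; apply: eq_map => x /=; rewrite cE.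
apply/poset_dataP; split=> [i /f_surj[x <-]|i /f_surj[x <-]|i j|i j l].
- by rewrite rE.
- by rewrite cE.
- move=> /f_surj[x <-] /f_surj[y <-]; rewrite !rE => le_xy le_yx; congr f.
  by apply: Order.POrderTheory.le_anti; rewrite le_xy.
- move=> /f_surj[x <-] /f_surj[y <-] /f_surj[z <-]; rewrite !rE.
  exact: Order.POrderTheory.le_trans.
Qed.

Section Realization.

Variables (k n : nat) (r : nat -> nat -> bool) (c : nat -> nat).
Hypothesis Hdata : poset_data k n r c.

(** A copy of ['I_n] on which the new order does not clash with the usual one; the proof [H] is an
    argument so that the order instance can recover it from the type. *)
Definition data_car (H : poset_data k n r c) : Type := 'I_n.

HB.instance Definition _ := Finite.on (data_car Hdata).

Definition data_le (i j : data_car Hdata) : bool := r (i : 'I_n) (j : 'I_n).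

Fact data_le_refl : reflexive data_le.
Proof. by case/poset_dataP: (Hdata) => H1 _ _ _ i; apply: H1 (ltn_ord _). Qed.

Fact data_le_anti : antisymmetric data_le.
Proof.
case/poset_dataP: (Hdata) => _ _ H3 _ i j /andP[rij rji]; apply: val_inj.
by apply: H3 rij rji; apply: ltn_ord.
Qed.

Fact data_le_trans : transitive data_le.
Proof.
case/poset_dataP: (Hdata) => _ _ _ H4 j i l; apply: H4; exact: ltn_ord.
Qed.

HB.instance Definition _ := Order.Le_isPOrder.Build (Order.Disp tt tt)
  (data_car Hdata) data_le_refl data_le_anti data_le_trans.

Fact data_label_subproof (i : 'I_n) : c i < k.
Proof. by case/poset_dataP: (Hdata) => _ H _ _; apply: H. Qed.

Definition data_kposet : kposet k :=
  @KPoset k _ (data_car Hdata) (fun i => Ordinal (data_label_subproof i)).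

Lemma data_kposet_presented :
  @presents k data_kposet n r c (fun i => val (i : 'I_n)).
Proof.
have fE : [seq val i | i <- enum 'I_n] = iota 0 n by rewrite val_enum_ord.
split=> //; last first.
  split; first exact: val_inj.
  by move=> i; split=> [lt_i|[x <-]]; [exists (Ordinal lt_i) | apply: ltn_ord].
rewrite /kposet_enc /poset_code -cats1 -!catA.
have -> : #|{: data_kposet}| = n.
  by rewrite cardE; exact: (size_enum_ord n).
have -> : [seq [seq r i j | j <- iota 0 n] | i <- iota 0 n] =
    [seq [seq r (val i) (val j) | j <- enum 'I_n] | i <- enum 'I_n].
  rewrite -{2}fE -[LHS]map_comp; apply: eq_map => i.
  by rewrite -fE -[LHS]map_comp.
by rewrite -fE -[X in _ = _ ++ _ ++ _ ++ flatten X]map_comp.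
Qed.

End Realization.

Section Transfer.

Variables (k : nat) (P P' : kposet k) (n n' : nat).
Variables (r r' : nat -> nat -> bool) (c c' : nat -> nat).
Variables (f : P -> nat) (f' : P' -> nat).
Hypotheses (Hf : presents n r c f) (Hf' : presents n' r' c' f').

Lemma hom_to_data (h : P -> P') : kposet_hom h -> exists2 g : nat -> nat,
  data_hom n r c n' r' c' g & forall x, g (f x) = f' (h x).
Proof.
case: Hf Hf' => [_ _ [f_inj f_surj] rE cE] [_ _ [_ f'_surj] r'E c'E] [h_mono h_lab].
pose g i := if [pick x : P | f x == i] is Some x then f' (h x) else 0.
have gE x : g (f x) = f' (h x).
  by rewrite /g; case: pickP => [y /eqP/f_inj-> //|/(_ x)]; rewrite eqxx.
exists g => //; split=> [i /f_surj[x <-]|i j /f_surj[x <-] /f_surj[y <-]].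
  by rewrite gE cE c'E h_lab; split=> //; apply/f'_surj; exists (h x).
by rewrite !gE rE r'E; apply: h_mono.
Qed.

Lemma hom_of_data g : data_hom n r c n' r' c' g ->
  exists2 h : P -> P', kposet_hom h & forall x, g (f x) = f' (h x).
Proof.
case: Hf Hf' => [_ _ [f_inj f_surj] rE cE] [_ _ [_ f'_surj] r'E c'E] [g_lab g_mono].
have f_lt x : f x < n by apply/f_surj; exists x.
have ex x : exists y, f' y == g (f x).
  by have [/f'_surj[y <-] _] := g_lab _ (f_lt x); exists y.
pose h x := xchoose (ex x).
have hE x : f' (h x) = g (f x) by apply/eqP; apply: (xchooseP (ex x)).
exists h => //; split=> [x y le_xy|x].
  by rewrite -r'E !hE; apply: g_mono; rewrite ?rE.
by apply: val_inj; rewrite /= -cE -c'E hE; case: (g_lab _ (f_lt x)).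
Qed.

End Transfer.

(** The language without quantification over types, in the form that a verifier can check. *)
Lemma kHOM_data k w : kHOM k w <-> exists n r c n' r' c',
  [/\ w = poset_code n r c ++ poset_code n' r' c', poset_data k n r c,
      poset_data k n' r' c' & exists h, data_hom n r c n' r' c' h].
Proof.
split=> [[[P P'] [/= -> [h Hh]]]|[n [r [c [n' [r' [c' [-> Hd Hd' [g Hg]]]]]]]]].
  have [n [r [c [f Hf]]]] := kposet_presented P.
  have [n' [r' [c' [f' Hf']]]] := kposet_presented P'.
  have [E D _ _ _] := Hf; have [E' D' _ _ _] := Hf'.
  exists n, r, c, n', r', c'; split=> //; first by rewrite E E'.
  by have [g] := hom_to_data Hf Hf' Hh; exists g.
exists (data_kposet Hd, data_kposet Hd') => /=.
have Hf := data_kposet_presented Hd; have Hf' := data_kposet_presented Hd'.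
have [-> _ _ _ _] := Hf; have [-> _ _ _ _] := Hf'; split=> //.
by have [h] := hom_of_data Hf Hf' Hg; exists h.
Qed.

Lemma kCORE_data k w : kCORE k w <-> exists n r c,
  [/\ w = poset_code n r c, poset_data k n r c
    & exists2 h, data_hom n r c n r c h & exists2 y, y < n & forall x, x < n -> h x <> y].
Proof.
split=> [[P [/= -> [h [Hh nsurj]]]]|[n [r [c [-> Hd [g Hg [y lt_y Hy]]]]]]].
  have [n [r [c [f Hf]]]] := kposet_presented P.
  have [E D [f_inj f_surj] _ _] := Hf.
  exists n, r, c; split=> //; have [g Hg gE] := hom_to_data Hf Hf Hh.
  exists g => //.
  have [y Hy] : exists y, y \notin codom h.
    apply/existsP; rewrite -negb_forall; apply/negP => /forallP H; apply: nsurj => y.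
    by have /codomP[x ->] := H y; exists x.
  exists (f y) => [|i /f_surj[x <-]]; first by apply/f_surj; exists y.
  by rewrite gE => /f_inj E'; rewrite -E' codom_f in Hy.
exists (data_kposet Hd) => /=.
have Hf := data_kposet_presented Hd; have [-> _ [f_inj f_surj] _ _] := Hf; split=> //.
have [h Hh hE] := hom_of_data Hf Hf Hg; exists h; split=> // surj.
have [y' Ey] := (f_surj y).1 lt_y; have [x Ex] := surj y'.
apply: (Hy (val (x : 'I_n))); first exact: ltn_ord.
by rewrite hE Ex.
Qed.

(** * Unique readability of the codes *)

Lemma nseq_inj_cat n n' (w w' : word) :
  nseq n true ++ false :: w = nseq n' true ++ false :: w' -> n = n' /\ w = w'.
Proof.
elim: n n' => [|n IH] [|n'] //=; first by case.
by case=> /IH[-> ->].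
Qed.

Lemma flatten_iota_inj n (V W : nat -> word) (v w : word) :
  (forall i, i < n -> size (V i) = size (W i)) ->
  flatten [seq V i | i <- iota 0 n] ++ v = flatten [seq W i | i <- iota 0 n] ++ w ->
  (forall i, i < n -> V i = W i) /\ v = w.
Proof.
elim: n v w => [|n IH] v w Hsz; first by move=> /= ->.
rewrite -addn1 iotaD !map_cat !flatten_cat /= !cats0 -!catA => E.
have [|HVW {}E] := IH _ _ _ E; first by move=> i lt_i; apply: Hsz; apply: ltnW.
have /eqP := E; rewrite eqseq_cat; last exact: Hsz.
case/andP=> /eqP Hn /eqP->; split=> // i; rewrite addn1 ltnS leq_eqVlt.
by case/orP=> [/eqP->|/HVW].
Qed.

Lemma labels_inj n (c c' : nat -> nat) (v w : word) :
  flatten [seq rcons (nseq (c i) true) false | i <- iota 0 n] ++ v =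
  flatten [seq rcons (nseq (c' i) true) false | i <- iota 0 n] ++ w ->
  (forall i, i < n -> c i = c' i) /\ v = w.
Proof.
elim: n v w => [|n IH] v w; first by move=> /= ->.
rewrite -addn1 iotaD !map_cat !flatten_cat /= !cats0 -!catA => E.
have [Hc {}E] := IH _ _ E; move: E; rewrite -!cats1 -!catA /=.
case/nseq_inj_cat => En ->; split=> // i; rewrite addn1 ltnS leq_eqVlt.
by case/orP=> [/eqP->|/Hc].
Qed.

(** The cardinality comes first and fixes the size of the matrix and the number of labels, so the
    end of a code is determined by its beginning. *)
Lemma poset_code_inj n r c n' r' c' v w :
  poset_code n r c ++ v = poset_code n' r' c' ++ w ->
  [/\ n = n', forall i j, i < n -> j < n -> r i j = r' i j,
      forall i, i < n -> c i = c' i & v = w].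
Proof.
rewrite /poset_code -!catA /= => /nseq_inj_cat[<-].
case/flatten_iota_inj => [i lt_i|Hr]; first by rewrite !size_map.
case/labels_inj => Hc ->; split=> // i j lt_i lt_j.
have := congr1 (nth false ^~ j) (Hr i lt_i).
by rewrite !(nth_map 0) ?size_iota // !nth_iota.
Qed.

Lemma PW_poset_code N R C : PF N ->
  PB (fun x u r => R x u (behead (behead r)) (head 0 (behead r)) (head 0 r)) ->
  PF (fun x u r => C x u (behead r) (head 0 r)) ->
  PW (fun x u r => poset_code (N x u r) (R x u r) (C x u r)).
Proof.
move=> HN HR HC; apply: PW_cat; first exact: PW_nseq.
apply: PW_cat; first exact: PW_const.
apply: PW_cat.
  apply: (PW_flatten (W := fun x u r i => [seq R x u r i j | j <- iota 0 (N x u r)])) => //.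
  exact: (PW_mkseq (B := fun x u r j => R x u (behead r) (head 0 r) j) (PF_skip 1 HN) HR).
apply: (PW_flatten (W := fun x u r i => rcons (nseq (C x u r i) true) false)) => //.
apply: PW_ext (PW_cat (PW_nseq true HC) (PW_const [:: false])) => x u r.
by rewrite cats1.
Qed.

Lemma PB_poset_data k N R C : PF N ->
  PB (fun x u r => R x u (behead (behead r)) (head 0 (behead r)) (head 0 r)) ->
  PF (fun x u r => C x u (behead r) (head 0 r)) ->
  PB (fun x u r => poset_data k (N x u r) (R x u r) (C x u r)).
Proof.
move=> HN HR HC.
have Rapp n A B : PF A -> PF B ->
    PB (fun x u r => R x u (iter n behead r) (A x u r) (B x u r)).
  by move=> HA HB; exact: (@PF_app2 n _ _ _ HR HB HA).
have v1 : PF (fun x u r => head 0 (behead r)) := PF_skip 1 PF_head.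
have v2 : PF (fun x u r => head 0 (behead (behead r))) := PF_skip 2 PF_head.
apply: PB_and; [|apply: PB_and].
- apply: (PB_all (B := fun x u r i => R x u r i i && (C x u r i < k))) => //.
  apply: PB_and; first exact: (Rapp 1 _ _ PF_head PF_head).
  exact: PB_leq (PF_succ HC) (PF_const k).
- apply: (PB_all (B := fun x u r i =>
    all (fun j => R x u r i j && R x u r j i ==> (i == j)) (iota 0 (N x u r)))) => //.
  apply: (PB_all (B := fun x u r j => R x u (behead r) (head 0 r) j &&
    R x u (behead r) j (head 0 r) ==> (head 0 r == j))); first exact: (PF_skip 1 HN).
  apply: PB_imp; last exact: PB_eqn v1 PF_head.
  apply: PB_and; [exact: (Rapp 2 _ _ v1 PF_head)|exact: (Rapp 2 _ _ PF_head v1)].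
- apply: (PB_all (B := fun x u r i => all (fun j => all (fun l =>
     R x u r i j && R x u r j l ==> R x u r i l) (iota 0 (N x u r)))
      (iota 0 (N x u r)))) => //.
  apply: (PB_all (B := fun x u r j => all (fun l =>
     R x u (behead r) (head 0 r) j && R x u (behead r) j l ==>
     R x u (behead r) (head 0 r) l) (iota 0 (N x u (behead r))))).
    exact: (PF_skip 1 HN).
  apply: (PB_all (B := fun x u r l =>
     R x u (behead (behead r)) (head 0 (behead r)) (head 0 r) &&
     R x u (behead (behead r)) (head 0 r) l ==>
     R x u (behead (behead r)) (head 0 (behead r)) l)).
    exact: (PF_skip 2 HN).
  apply: PB_imp; last exact: (Rapp 3 _ _ v2 PF_head).
  apply: PB_and; [exact: (Rapp 3 _ _ v2 v1)|exact: (Rapp 3 _ _ v1 PF_head)].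
Qed.

(** * Proof search for definability by terms *)

Ltac pf_skip H :=
  first [ exact H | exact (PF_skip 1 H) | exact (PF_skip 2 H) | exact (PF_skip 3 H)
        | exact (PF_skip 4 H) | exact (PF_skip 5 H) | exact (PF_skip 6 H) ].

(** Second-order patterns recover the subterms as functions of [x u r], so the shape of the goal
    selects the closure lemma. *)
Ltac pf_rule :=
  cbv beta;
  lazymatch goal with
  | |- PF (fun x u r => S (@?F x u r)) => apply (@PF_succ F)
  | |- PF (fun x u r => addn (@?F x u r) (@?G x u r)) => apply (@PF_add F G)
  | |- PF (fun x u r => subn (@?F x u r) (@?G x u r)) => apply (@PF_sub F G)
  | |- PF (fun x u r => muln (@?F x u r) (@?G x u r)) => apply (@PF_mul F G)
  | |- PF (fun x u r => divn (@?F x u r) (@?G x u r)) => apply (@PF_div F G)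
  | |- PF (fun x u r => modn (@?F x u r) (@?G x u r)) => apply (@PF_mod F G)
  | |- PF (fun x u r => expn (@?F x u r) ?n) => apply (@PF_exp F n)
  | |- PF (fun x u r => nat_of_bool (@?B x u r)) => change (PB B)
  | |- PF (fun x u r => head 0 r) => exact PF_head
  | |- PF (fun x u r => head 0 _) => pf_skip PF_head
  | |- PF (fun x u r => size x) => exact PF_size_x
  | |- PF (fun x u r => size u) => exact PF_size_u
  | |- PB (fun x u r => leq (@?F x u r) (@?G x u r)) => apply (@PB_leq F G)
  | |- PB (fun x u r => negb (@?B x u r)) => apply (@PB_neg B)
  | |- PB (fun x u r => andb (@?B x u r) (@?C x u r)) => apply (@PB_and B C)
  | |- PB (fun x u r => orb (@?B x u r) (@?C x u r)) => apply (@PB_or B C)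
  | |- PB (fun x u r => implb (@?B x u r) (@?C x u r)) => apply (@PB_imp B C)
  | |- PB (fun x u r => odd (@?F x u r)) => apply (@PB_odd F)
  | |- PB (fun x u r => @eq_op bool (@?F x u r) (@?G x u r)) => apply (@PB_eqb F G)
  | |- PB (fun x u r => @eq_op (seq bool) (@?F x u r) (@?G x u r)) => apply (@PB_eqw F G)
  | |- PB (fun x u r => @eq_op _ (@?F x u r) (@?G x u r)) => apply (@PB_eqn F G)
  | |- PB (fun x u r => nth false x (@?F x u r)) => apply (@PB_bit_x F)
  | |- PB (fun x u r => nth false u (@?F x u r)) => apply (@PB_bit_u F)
  | |- PB (fun x u r => all (@?B x u r) (iota 0 (@?F x u r))) =>
      apply (@PB_all F B)
  | |- PB (fun x u r => has (@?B x u r) (iota 0 (@?F x u r))) =>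
      apply (@PB_has F B)
  end.

Ltac pf_hyp :=
  match goal with
  | H : PF _ |- PF _ => pf_skip H
  | H : PB _ |- PB _ => pf_skip H
  end.

Ltac pf_const := first [ exact (PF_const _) | exact (PB_const _) ].

Ltac pf := repeat first [ pf_const | pf_rule | pf_hyp ].

Section Certificates.

Variable k : nat.

(** * Membership in NP *)

(* A certificate is read as a matrix of bits of width [cert_width x], whose row
   [6 * i + t] describes the [i]-th element: [t = 0, 1] its label in either
   k-poset and [t = 2] its image, in unary; [t = 3, 4] its rows of the two orders.
   For [t = 5], the rows [i = 0, 1] hold the cardinalities in unary. *)
Definition cert_width (x : word) : nat := size x + k.

Definition cert_bit (x u : word) (t i l : nat) : bool :=
  nth false u ((6 * i + t) * cert_width x + l).

(** Counting the true bits of a row, in any order, makes every word decode to some data. *)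
Definition cert_num (x u : word) (t i : nat) : nat :=
  \sum_(l < cert_width x) cert_bit x u t i l.

Lemma PB_cert_bit t A B : PF A -> PF B ->
  PB (fun x u r => cert_bit x u t (A x u r) (B x u r)).
Proof. by move=> HA HB; rewrite /cert_bit /cert_width; pf. Qed.

Lemma PF_cert_num t A : PF A -> PF (fun x u r => cert_num x u t (A x u r)).
Proof.
move=> HA; rewrite /cert_num.
apply: (PF_sum (G := fun x u r l => nat_of_bool (cert_bit x u t (A x u r) l))).
  by rewrite /cert_width; pf.
exact: PB_cert_bit (PF_skip 1 HA) PF_head.
Qed.

(** The summand 2 guarantees the rows [i = 0, 1] for the two cardinalities. *)
Definition cert_of (x : word) (G : nat -> nat -> nat -> bool) : word :=
  let W := cert_width x in
  mkseq (fun p => G (p %/ W %% 6) (p %/ W %/ 6) (p %% W)) (6 * (W + 2) * W).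

Definition cert_len : {poly nat} := (6%N%:P * (('X + k%:P) + 2%N%:P) * ('X + k%:P))%R.

Lemma size_cert_of x G : size (cert_of x G) = (cert_len.[size x])%R.
Proof.
by rewrite size_mkseq !(hornerM, hornerD, hornerC, hornerX).
Qed.

Lemma cert_bit_of x G t i l : i < cert_width x + 2 -> t < 6 -> l < cert_width x ->
  cert_bit x (cert_of x G) t i l = G t i l.
Proof.
rewrite /cert_bit /cert_of; set W := cert_width x => lt_i lt_t lt_l.
have W0 : 0 < W by apply: leq_ltn_trans lt_l.
rewrite nth_mkseq; last first.
  apply: (@leq_trans ((6 * i + t).+1 * W)); first by rewrite mulSn; lia.
  by rewrite leq_mul2r; apply/orP; right; lia.
rewrite divnMDl // (divn_small lt_l) addn0 modnMDl (modn_small lt_l).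
by rewrite ![6 * i]mulnC modnMDl divnMDl // modn_small // divn_small // addn0.
Qed.

Lemma cert_num_of x G t i a : i < cert_width x + 2 -> t < 6 -> a <= cert_width x ->
  (forall l, l < cert_width x -> G t i l = (l < a)) ->
  cert_num x (cert_of x G) t i = a.
Proof.
move=> lt_i lt_t le_a HG; rewrite -[RHS](sum_ltn le_a).
apply: eq_bigr => l _; congr nat_of_bool.
by rewrite cert_bit_of // HG.
Qed.

Definition hom_check n (r : nat -> nat -> bool) c n' (r' : nat -> nat -> bool) c'
    (h : nat -> nat) : bool :=
  all (fun i => (h i < n') && (c i == c' (h i) :> nat)) (iota 0 n) &&
  all (fun i => all (fun j => r i j ==> r' (h i) (h j)) (iota 0 n)) (iota 0 n).

Lemma hom_checkP n r c n' r' c' h :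
  reflect (data_hom n r c n' r' c' h) (hom_check n r c n' r' c' h).
Proof.
apply: (iffP andP) => [[/all_iotaP H1 /all_iotaP H2]|[H1 H2]]; split.
- by move=> i /H1/andP[-> /eqP].
- by move=> i j /H2/all_iotaP Hi /Hi/implyP.
- by apply/all_iotaP => i /H1[-> ->]; rewrite eqxx.
- by apply/all_iotaP => i Hi; apply/all_iotaP => j Hj; apply/implyP; apply: H2.
Qed.

(** Instead of parsing [x], the verifier takes the decoded k-posets from the certificate, encodes
    them and compares the result with [x]. *)
Definition hom_verifier (x u : word) : bool :=
  let n := cert_num x u 5 0 in let n' := cert_num x u 5 1 in
  let r := cert_bit x u 3 in let r' := cert_bit x u 4 in
  let c := cert_num x u 0 in let c' := cert_num x u 1 in
  [&& x == poset_code n r c ++ poset_code n' r' c', poset_data k n r c,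
      poset_data k n' r' c' & hom_check n r c n' r' c' (cert_num x u 2)].

Definition core_verifier (x u : word) : bool :=
  let n := cert_num x u 5 0 in
  let r := cert_bit x u 3 in let c := cert_num x u 0 in
  let h := cert_num x u 2 in
  [&& x == poset_code n r c, poset_data k n r c, hom_check n r c n r c h
    & has (fun y => all (fun i => h i != y) (iota 0 n)) (iota 0 n)].

Lemma PW_x : PW (fun x u r => x).
Proof. by split; pf. Qed.

Lemma PW_cert_code t5 t3 t0 : PW (fun x u r =>
  poset_code (cert_num x u 5 t5) (cert_bit x u t3) (cert_num x u t0)).
Proof.
apply: (PW_poset_code (N := fun x u r => cert_num x u 5 t5)
  (R := fun x u r => cert_bit x u t3) (C := fun x u r => cert_num x u t0)).
- exact: PF_cert_num (PF_const _).
- by apply: PB_cert_bit; pf.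
- exact: PF_cert_num PF_head.
Qed.

Lemma PB_cert_data t5 t3 t0 : PB (fun x u r =>
  poset_data k (cert_num x u 5 t5) (cert_bit x u t3) (cert_num x u t0)).
Proof.
apply: (PB_poset_data k (N := fun x u r => cert_num x u 5 t5)
  (R := fun x u r => cert_bit x u t3) (C := fun x u r => cert_num x u t0)).
- exact: PF_cert_num (PF_const _).
- by apply: PB_cert_bit; pf.
- exact: PF_cert_num PF_head.
Qed.

Lemma PB_hom_verifier : PB (fun x u r => hom_verifier x u).
Proof.
rewrite /hom_verifier /hom_check; apply: PB_and.
  exact: PB_eqw PW_x (PW_cat (PW_cert_code 0 3 0) (PW_cert_code 1 4 1)).
apply: PB_and; first exact: PB_cert_data.
apply: PB_and; first exact: PB_cert_data.
by repeat first [pf_const | pf_rule | apply: PF_cert_num | apply: PB_cert_bit].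
Qed.

Lemma PB_core_verifier : PB (fun x u r => core_verifier x u).
Proof.
rewrite /core_verifier /hom_check; apply: PB_and.
  exact: PB_eqw PW_x (PW_cert_code 0 3 0).
apply: PB_and; first exact: PB_cert_data.
by repeat first [pf_const | pf_rule | apply: PF_cert_num | apply: PB_cert_bit].
Qed.

Lemma poset_code_ext n r c r' c' :
  (forall i j, i < n -> j < n -> r i j = r' i j) ->
  (forall i, i < n -> c i = c' i) -> poset_code n r c = poset_code n r' c'.
Proof.
move=> Hr Hc; rewrite /poset_code; congr (_ ++ _ ++ flatten _ ++ flatten _).
  apply/eq_in_map => i; rewrite mem_iota => Hi; apply/eq_in_map => j.
  by rewrite mem_iota => Hj; apply: Hr.
by apply/eq_in_map => i; rewrite mem_iota => Hi; rewrite Hc.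
Qed.

Lemma poset_data_ext n r c r' c' :
  (forall i j, i < n -> j < n -> r i j = r' i j) ->
  (forall i, i < n -> c i = c' i) -> poset_data k n r c -> poset_data k n r' c'.
Proof.
move=> Hr Hc /poset_dataP[H1 H2 H3 H4]; apply/poset_dataP; split.
- by move=> i Hi; rewrite -Hr ?H1.
- by move=> i Hi; rewrite -Hc ?H2.
- by move=> i j Hi Hj; rewrite -!Hr //; apply: H3.
- by move=> i j l Hi Hj Hl; rewrite -!Hr //; apply: H4.
Qed.

Lemma size_poset_code n r c : n <= size (poset_code n r c).
Proof. by rewrite /poset_code !size_cat size_nseq leq_addr. Qed.

Definition cert_fill n (r : nat -> nat -> bool) (c : nat -> nat)
   n' (r' : nat -> nat -> bool) (c' h : nat -> nat) (t i l : nat) : bool :=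
  match t with
  | 0 => l < c i
  | 1 => l < c' i
  | 2 => l < h i
  | 3 => r i l
  | 4 => r' i l
  | _ => l < (if i is 0 then n else n')
  end.

Lemma NP_kHOM : NP (kHOM k).
Proof.
exists hom_verifier, cert_len; split; first exact: polytime_pred2_of PB_hom_verifier.
move=> x; split=> [/kHOM_data|[u [_ /and4P[/eqP E D D' /hom_checkP H]]]]; last first.
  apply/kHOM_data; do 6 eexists; split; [exact: E|exact: D|exact: D'|].
  by exists (cert_num x u 2).
move=> [n [r [c [n' [r' [c' [E D D' [h H]]]]]]]].
pose G := cert_fill n r c n' r' c' h.
exists (cert_of x G); split; first by rewrite size_cert_of.
have [_ c_lt _ _] := poset_dataP _ _ _ _ D.
have [_ c'_lt _ _] := poset_dataP _ _ _ _ D'.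
have le_n : n <= size x.
  by rewrite E size_cat; apply: leq_trans (size_poset_code n r c) (leq_addr _ _).
have le_n' : n' <= size x.
  by rewrite E size_cat; apply: leq_trans (size_poset_code n' r' c') (leq_addl _ _).
have W : cert_width x = size x + k by [].
have [H1 H2] := H.
have num a t i : i < cert_width x + 2 -> t < 6 -> a <= cert_width x ->
   (forall l, G t i l = (l < a)) -> cert_num x (cert_of x G) t i = a.
  by move=> *; apply: cert_num_of.
have En : cert_num x (cert_of x G) 5 0 = n by apply: num => //; lia.
have En' : cert_num x (cert_of x G) 5 1 = n' by apply: num => //; lia.
have Ec i : i < n -> c i = cert_num x (cert_of x G) 0 i.
  by move=> lt_i; apply/esym/num => //; have := c_lt i lt_i; lia.
have Ec' i : i < n' -> c' i = cert_num x (cert_of x G) 1 i.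
  by move=> lt_i; apply/esym/num => //; have := c'_lt i lt_i; lia.
have Eh i : i < n -> cert_num x (cert_of x G) 2 i = h i.
  by move=> lt_i; apply/num => //; have [? _] := H1 i lt_i; lia.
have Er i j : i < n -> j < n -> r i j = cert_bit x (cert_of x G) 3 i j.
  by move=> lt_i lt_j; rewrite cert_bit_of //; lia.
have Er' i j : i < n' -> j < n' -> r' i j = cert_bit x (cert_of x G) 4 i j.
  by move=> lt_i lt_j; rewrite cert_bit_of //; lia.
rewrite /hom_verifier; cbv zeta; rewrite En En'; apply/and4P; split.
- by rewrite {1}E (poset_code_ext Er Ec) (poset_code_ext Er' Ec').
- exact: poset_data_ext Er Ec D.
- exact: poset_data_ext Er' Ec' D'.
apply/hom_checkP; split=> [i lt_i|i j lt_i lt_j].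
  by have [lt_h E'] := H1 i lt_i; rewrite Eh // -Ec // -Ec'.
have [? _] := H1 i lt_i; have [? _] := H1 j lt_j.
by rewrite -Er // !Eh // -Er' //; apply: H2.
Qed.

Lemma NP_kCORE : NP (kCORE k).
Proof.
exists core_verifier, cert_len; split; first exact: polytime_pred2_of PB_core_verifier.
move=> x; split=> [/kCORE_data|[u [_ /and4P[/eqP E D /hom_checkP H]]]]; last first.
  case/has_iotaP=> y Hy /all_iotaP Hs; apply/kCORE_data; do 3 eexists; split; [exact: E|exact: D|].
  exists (cert_num x u 2) => //; exists y => // i Hi; apply/eqP; exact: Hs.
move=> [n [r [c [E D [h H [y lt_y Hy]]]]]].
pose G := cert_fill n r c n r c h.
exists (cert_of x G); split; first by rewrite size_cert_of.
have [_ c_lt _ _] := poset_dataP _ _ _ _ D.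
have le_n : n <= size x by rewrite E size_poset_code.
have W : cert_width x = size x + k by [].
have [H1 H2] := H.
have num a t i : i < cert_width x + 2 -> t < 6 -> a <= cert_width x ->
   (forall l, G t i l = (l < a)) -> cert_num x (cert_of x G) t i = a.
  by move=> *; apply: cert_num_of.
have En : cert_num x (cert_of x G) 5 0 = n by apply: num => //; lia.
have Ec i : i < n -> c i = cert_num x (cert_of x G) 0 i.
  by move=> lt_i; apply/esym/num => //; have := c_lt i lt_i; lia.
have Eh i : i < n -> cert_num x (cert_of x G) 2 i = h i.
  by move=> lt_i; apply/num => //; have [? _] := H1 i lt_i; lia.
have Er i j : i < n -> j < n -> r i j = cert_bit x (cert_of x G) 3 i j.
  by move=> lt_i lt_j; rewrite cert_bit_of //; lia.
rewrite /core_verifier; cbv zeta; rewrite En; apply/and4P; split.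
- by rewrite {1}E (poset_code_ext Er Ec).
- exact: poset_data_ext Er Ec D.
- apply/hom_checkP; split=> [i lt_i|i j lt_i lt_j].
    by have [lt_h E'] := H1 i lt_i; rewrite Eh // -!Ec.
  have [? _] := H1 i lt_i; have [? _] := H1 j lt_j.
  by rewrite -Er // !Eh // -Er //; apply: H2.
- apply/has_iotaP; exists y => //; apply/all_iotaP => i lt_i.
  by rewrite Eh //; apply/eqP/Hy.
Qed.

End Certificates.

(** * Digraphs and k-posets *)

(* A vertex [x] of a digraph becomes four elements [(x, c)], [c < 4], labelled by
   the parity of [c]. The fence [(x, 0) < (x, 2) > (x, 1) < (x, 3)] keeps them
   together, and an edge [E x y] is coded by [(x, 0) < (y, 3)]. *)
Definition gadget_rel (E : nat -> nat -> bool) (x a y b : nat) : bool :=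
  (x == y) && [|| a == b, (a == 0) && (b == 2), (a == 1) && (b == 2)
                | (a == 1) && (b == 3)]
  || [&& a == 0, b == 3 & E x y].

(** The number [i] stands for the element [(lo + i %/ 4, i %% 4)]. The offset [lo] allows k-posets
    for different intervals of vertices of one digraph. *)
Definition block_rel (E : nat -> nat -> bool) (lo i j : nat) : bool :=
  gadget_rel E (lo + i %/ 4) (i %% 4) (lo + j %/ 4) (j %% 4).

(** All strict relations lead from levels 0, 1 to levels 2, 3. So there are no chains of three
    elements, and the order axioms hold for every [E]. *)
Lemma block_data k E lo n : 1 < k ->
  poset_data k (4 * n) (block_rel E lo) (fun i => nat_of_bool (odd i)).
Proof.
move=> lt1k; apply/poset_dataP; split.
- by move=> i _; rewrite /block_rel /gadget_rel !eqxx.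
- by move=> i _; case: (odd i) => /=; lia.
- move=> i j _ _; rewrite /block_rel /gadget_rel => rij rji.
  have ha := ltn_pmod i (isT : 0 < 4); have hb := ltn_pmod j (isT : 0 < 4).
  rewrite (divn_eq i 4) (divn_eq j 4).
  move: rij rji ha hb; rewrite !eqn_add2l.
  move: (i %/ 4) (j %/ 4) (i %% 4) (j %% 4) => x y a b.
  case/orP=> [/andP[/eqP-> H1]|/and3P[/eqP-> /eqP-> _]]; last first.
    by case/orP=> [/andP[/eqP-> H2]|/and3P[/eqP]//]; lia.
  case/orP=> [/andP[_ H2]|/and3P[/eqP E1 /eqP E2 _]]; last by subst; lia.
  by move=> _ _; congr (_ + _); lia.
- move=> i j l _ _ _; rewrite /block_rel /gadget_rel !eqn_add2l.
  move: (i %/ 4) (j %/ 4) (l %/ 4) (i %% 4) (j %% 4) (l %% 4) => x y z a b c.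
  case/orP=> [/andP[/eqP<- H1]|/and3P[/eqP-> /eqP-> Exy]]; last first.
    case/orP=> [/andP[/eqP<- H2]|/and3P[/eqP]//].
    by apply/orP; right; rewrite Exy andbT; lia.
  case/orP=> [/andP[-> H2]|/and3P[/eqP E1 -> Exz]].
    by apply/orP; left; lia.
  by apply/orP; right; rewrite Exz /=; subst; lia.
Qed.

Section Blocks.

Variables (E : nat -> nat -> bool) (lo n lo' n' : nat).

Lemma block_hom_of g :
  (forall x, lo <= x < lo + n -> lo' <= g x < lo' + n') ->
  (forall x y, lo <= x < lo + n -> lo <= y < lo + n -> E x y -> E (g x) (g y)) ->
  data_hom (4 * n) (block_rel E lo) (fun i => nat_of_bool (odd i))
    (4 * n') (block_rel E lo') (fun i => nat_of_bool (odd i))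
    (fun i => 4 * (g (lo + i %/ 4) - lo') + i %% 4).
Proof.
move=> Hg HE; have Hx i : i < 4 * n -> lo <= lo + i %/ 4 < lo + n.
  by move=> lt_i; rewrite leq_addr ltn_add2l ltn_divLR // mulnC.
have D i : (4 * (g (lo + i %/ 4) - lo') + i %% 4) %/ 4 = g (lo + i %/ 4) - lo'.
  by rewrite mulnC divnMDl // (divn_small (ltn_pmod i (isT : 0 < 4))) addn0.
have M i : (4 * (g (lo + i %/ 4) - lo') + i %% 4) %% 4 = i %% 4.
  by rewrite mulnC modnMDl modn_mod.
split=> [i lt_i|i j lt_i lt_j].
  have := Hg _ (Hx i lt_i); have := ltn_pmod i (isT : 0 < 4).
  split; first by lia.
  by rewrite oddD oddM /= {1}(divn_eq i 4) oddD oddM andbF.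
rewrite /block_rel !D !M /gadget_rel => H.
have /andP[Hi _] := Hg _ (Hx i lt_i); have /andP[Hj _] := Hg _ (Hx j lt_j).
rewrite !subnKC //; case/orP: H => [/andP[/eqP-> ->]|/and3P[-> -> HEij]].
  by rewrite eqxx.
by rewrite HE ?Hx // orbT.
Qed.

Hypothesis Eout : forall x, lo <= x < lo + n ->
  exists2 y, lo <= y < lo + n & E x y.
Hypothesis Ein : forall x, lo <= x < lo + n ->
  exists2 y, lo <= y < lo + n & E y x.

(** Labels are parities of levels. The only relation from an odd to an even level is 1 < 2, within
    one vertex, so [(x, 1)] and [(x, 2)] keep their levels and stay together. The only relation from
    an even to an odd level is 0 < 3, an edge; hence edges are preserved once [(x, 0)] and [(x, 3)]
    follow. *)
Lemma block_hom_to h :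
  data_hom (4 * n) (block_rel E lo) (fun i => nat_of_bool (odd i))
    (4 * n') (block_rel E lo') (fun i => nat_of_bool (odd i)) h ->
  exists g, [/\ forall x, lo <= x < lo + n -> lo' <= g x < lo' + n',
    forall x y, lo <= x < lo + n -> lo <= y < lo + n -> E x y -> E (g x) (g y)
    & forall i, i < 4 * n -> h i = 4 * (g (lo + i %/ 4) - lo') + i %% 4].
Proof.
case=> Hlab Hrel.
pose e x c := 4 * (x - lo) + c.
have eD x c : lo <= x -> c < 4 -> lo + e x c %/ 4 = x.
  by move=> le_x lt_c; rewrite /e mulnC divnMDl // divn_small // addn0 subnKC.
have eM x c : c < 4 -> e x c %% 4 = c.
  by move=> lt_c; rewrite /e mulnC modnMDl modn_small.
have e_lt x c : lo <= x < lo + n -> c < 4 -> e x c < 4 * n by rewrite /e; lia.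
pose V x c := lo' + h (e x c) %/ 4; pose K x c := h (e x c) %% 4.
have K_lt x c : K x c < 4 by rewrite ltn_pmod.
have K_odd x c : lo <= x < lo + n -> c < 4 -> odd (K x c) = odd c.
  move=> Hx lt_c; have [_] := Hlab _ (e_lt _ _ Hx lt_c).
  rewrite /K /e oddD oddM /= => Ec; have := oddD (h (e x c) %/ 4 * 4) (h (e x c) %% 4).
  rewrite -divn_eq oddM andbF /= => <-; move: Ec; rewrite /e.
  by case: (odd c); case: (odd (h _)).
have Hgad x a y b : lo <= x < lo + n -> lo <= y < lo + n -> a < 4 -> b < 4 ->
    gadget_rel E x a y b -> gadget_rel E (V x a) (K x a) (V y b) (K y b).
  move=> Hx Hy lt_a lt_b H; have /andP[lex _] := Hx; have /andP[ley _] := Hy.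
  apply: Hrel; rewrite ?e_lt //.
  by rewrite /block_rel !eD // !eM.
have HA x : lo <= x < lo + n -> [/\ K x 2 = 2, K x 1 = 1 & V x 1 = V x 2].
  move=> Hx; have := Hgad x 1 x 2 Hx Hx isT isT; rewrite /gadget_rel !eqxx => /(_ isT).
  have := K_lt x 1; have := K_lt x 2.
  have := K_odd x 1 Hx isT; have := K_odd x 2 Hx isT.
  case: (K x 1) => [|[|[|[|]]]] //; case: (K x 2) => [|[|[|[|]]]] //= _ _ _ _.
  - by rewrite andbF.
  - by rewrite orbF andbT => /eqP.
  - by rewrite andbF.
  - by rewrite andbF.
have HE x y : lo <= x < lo + n -> lo <= y < lo + n -> E x y ->
    [/\ K x 0 = 0, K y 3 = 3 & E (V x 0) (V y 3)].
  move=> Hx Hy Exy; have := Hgad x 0 y 3 Hx Hy isT isT.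
  rewrite /gadget_rel Exy /= orbT => /(_ isT).
  have := K_lt x 0; have := K_lt y 3.
  have := K_odd x 0 Hx isT; have := K_odd y 3 Hy isT.
  case: (K x 0) => [|[|[|[|]]]] //; case: (K y 3) => [|[|[|[|]]]] //= _ _ _ _;
    by rewrite ?andbF ?orbF //= ?andbF.
(* An outgoing edge keeps [(x, 0)] at level 0; at a sink it could collapse onto the image of
   [(x, 2)]. Dually for [(x, 3)] and incoming edges. *)
have HM x : lo <= x < lo + n -> K x 0 = 0 /\ V x 0 = V x 2.
  move=> Hx; have [y Hy Exy] := Eout Hx; have [K0 _ _] := HE x y Hx Hy Exy.
  split=> //; have := Hgad x 0 x 2 Hx Hx isT isT; have [K2 _ _] := HA x Hx.
  by rewrite /gadget_rel K0 K2 !eqxx => /(_ isT) /=; rewrite orbF andbT => /eqP.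
have HP x : lo <= x < lo + n -> K x 3 = 3 /\ V x 3 = V x 2.
  move=> Hx; have [y Hy Eyx] := Ein Hx; have [_ K3 _] := HE y x Hy Hx Eyx.
  split=> //; have := Hgad x 1 x 3 Hx Hx isT isT; have [_ K1 <-] := HA x Hx.
  by rewrite /gadget_rel K1 K3 !eqxx => /(_ isT) /=; rewrite orbF andbT => /eqP.
exists (fun x => V x 2); split.
- move=> x Hx; rewrite leq_addr ltn_add2l ltn_divLR // mulnC.
  by have [] := Hlab _ (e_lt x 2 Hx isT).
- move=> x y Hx Hy Exy; have [_ <-] := HM x Hx; have [_ <-] := HP y Hy.
  by have [] := HE x y Hx Hy Exy.
- move=> i lt_i; set x := lo + i %/ 4; set c := i %% 4.
  have Hx : lo <= x < lo + n by rewrite leq_addr ltn_add2l ltn_divLR // mulnC.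
  have -> : i = e x c by rewrite /e addKn mulnC -divn_eq.
  have lt_c : c < 4 by rewrite ltn_pmod.
  have -> : 4 * (V x 2 - lo') + c = 4 * (V x c - lo') + K x c.
    have [? ?] := HM x Hx; have [? ?] := HP x Hx; have [? ? ?] := HA x Hx.
    by case: (c) lt_c => [|[|[|[|]]]] //= _; congr (4 * (_ - _) + _).
  by rewrite /V addKn mulnC -divn_eq.
Qed.

End Blocks.

(** A binary constraint satisfaction problem with [m] variables and [d] values. *)
Definition selectable (m d : nat) (C : nat -> nat -> nat -> nat -> bool) : Prop :=
  exists s : nat -> nat, (forall t, t < m -> s t < d) /\
    (forall t t', t < t' -> t' < m -> C t (s t) t' (s t')).

(* [VV t] stands for the [t]-th variable and [VW t e] for its value [e]. The
   directed path of the [VR i] pins everything down but the [VV t], which may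
   move to some [VW t e]. As [VG] is joined to all other vertices in both
   directions, there are neither sources nor sinks. *)
Inductive vertex : Type := VV (t : nat) | VR (i : nat) | VG | VW (t e : nat).

(** * The digraph of a constraint problem *)

Section Digraph.

Variables (m d : nat) (C : nat -> nat -> nat -> nat -> bool).
Hypothesis m_gt0 : 0 < m.

Let mid := 2 * m + 1.
Let top := mid + m * d.

Definition vvalid (a : vertex) : bool :=
  match a with
  | VV t => t < m
  | VR i => i <= 2 * m + 1 + m * d
  | VG => true
  | VW t e => (t < m) && (e < d)
  end.

(** [VR t] marks a variable and its values, and [VR (2 * m + 1 + (t * d + e))] marks the pair of [t]
    and [e]. The path indices from [m + 1] to [2 * m] leave room for the heights of the variables.
    All pairs [t < t'] of variables are edges, so that edges between values express [C]. *)
Definition vedge (a b : vertex) : bool :=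
  match a, b with
  | VG, VG => false
  | VG, _ => true
  | _, VG => true
  | VV t, VV t' => t < t'
  | VV t, VR i => i == 2 * m + 1 + m * d
  | VV t, VW _ _ => false
  | VR i, VV t => i == t
  | VR i, VR j => j == i.+1
  | VR i, VW t _ => i == t
  | VW _ _, VV _ => false
  | VW t e, VR j => (j == 2 * m + 1 + m * d) || (j == 2 * m + 1 + (t * d + e))
  | VW t e, VW t' e' => (t < t') && C t e t' e'
  end.

Definition is_VG (a : vertex) : bool := if a is VG then true else false.
Definition is_VV (a : vertex) : bool := if a is VV _ then true else false.
Definition is_VW (a : vertex) : bool := if a is VW _ _ then true else false.

(* Strictly increasing along the edges that avoid [VG], and equal to [i] on
   [VR i], the path having maximal length. *)
Definition height (a : vertex) : nat :=
  match a with
  | VV t => m + 1 + t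
  | VR i => i
  | VG => 0
  | VW t _ => m + 1 + t
  end.

Lemma offset_lt t e : t < m -> e < d -> t * d + e < m * d.
Proof.
move=> lt_t lt_e; apply: (@leq_trans (t.+1 * d)); first by rewrite mulSn; lia.
by rewrite leq_mul2r lt_t orbT.
Qed.

Lemma height_lt a b : vvalid a -> vvalid b -> ~~ is_VG a -> ~~ is_VG b ->
  vedge a b -> height a < height b.
Proof.
case: a => [t|i||t e]; case: b => [t'|j||t' e'] //=; lia.
Qed.

Lemma height_leq a : vvalid a -> height a <= top.
Proof. by rewrite /top /mid; case: a => [t|i||t e] //=; lia. Qed.

(** * Rigidity of the path and of the values *)

Section Rigidity.

(** [S] is the domain: all vertices for CORE, all but the values for HOM. *)
Variables (S : pred vertex) (h : vertex -> vertex).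
Hypothesis S_valid : forall a, S a -> vvalid a.
Hypothesis S_path : forall i, i <= top -> S (VR i).
Hypothesis S_VG : S VG.
Hypothesis h_valid : forall a, S a -> vvalid (h a).
Hypothesis h_edge : forall a b, S a -> S b -> vedge a b -> vedge (h a) (h b).

(** [VG] lies on 2-cycles with all other vertices, and by heights every 2-cycle passes through [VG].
    If [VG] moved, all others would go to [VG], and the edge from [VR 0] to [VR 1] would give a
    loop. *)
Lemma hom_VG : h VG = VG.
Proof.
suff : is_VG (h VG) by case: (h VG).
apply/negPn/negP => hG.
have H a : S a -> ~~ is_VG a -> is_VG (h a).
  move=> Sa aG; apply/negPn/negP => haG.
  have E1 : vedge (h VG) (h a) by apply: h_edge => //; case: (a) aG.
  have E2 : vedge (h a) (h VG) by apply: h_edge => //; case: (a) aG.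
  have := height_lt (h_valid S_VG) (h_valid Sa) hG haG E1.
  have := height_lt (h_valid Sa) (h_valid S_VG) haG hG E2.
  lia.
have S0 : S (VR 0) by apply: S_path.
have S1 : S (VR 1) by apply: S_path; rewrite /top /mid; lia.
have := h_edge S0 S1 isT; have := H _ S0 isT; have := H _ S1 isT.
by case: (h (VR 0)) => //; case: (h (VR 1)).
Qed.

Lemma hom_not_VG a : S a -> ~~ is_VG a -> ~~ is_VG (h a).
Proof.
move=> Sa aG; have : vedge (h VG) (h a) by apply: h_edge => //; case: (a) aG.
by rewrite hom_VG; case: (h a).
Qed.

Lemma hom_path_step i : i < top -> height (h (VR i)) < height (h (VR i.+1)).
Proof.
move=> lt_i; have Si := S_path (ltnW lt_i); have Si1 := S_path lt_i.
apply: height_lt; rewrite ?h_valid ?hom_not_VG //.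
by apply: h_edge => //=.
Qed.

(** The heights of [top.+1] images increase strictly within [0..top], which leaves no choice. *)
Lemma hom_path_height i : i <= top -> height (h (VR i)) = i.
Proof.
move=> le_i; apply/eqP; rewrite eqn_leq; apply/andP; split.
  have : forall j, j <= top -> height (h (VR (top - j))) <= top - j.
    elim=> [_|j IH lt_j]; first by rewrite subn0; apply: height_leq; apply: h_valid; apply: S_path.
    have := IH (ltnW lt_j); have := @hom_path_step (top - j.+1).
    have -> : (top - j.+1).+1 = top - j by lia.
    lia.
  by move=> /(_ (top - i)); rewrite subKn //; apply; apply: leq_subr.
elim: i le_i => // i IH lt_i.
by have := hom_path_step lt_i; have := IH (ltnW lt_i); lia.
Qed.

(** Up to [m], the height determines the vertex. From [VR m] on, edges to variables and values have
    ended, so the path can only be followed. *)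
Lemma hom_path i : i <= top -> h (VR i) = VR i.
Proof.
have [le_im|] := leqP i m.
  move=> le_i; have := hom_path_height le_i; have := hom_not_VG (S_path le_i) isT.
  by case: (h (VR i)) => [t|j||t e] //= _; [lia | move=> -> | lia].
elim: i => // i IH lt_mi lt_i.
have Ei : h (VR i) = VR i.
  have [le_im|lt_im] := leqP i m; last by apply: IH => //; apply: ltnW.
  have le_i := ltnW lt_i.
  have := hom_path_height le_i; have := hom_not_VG (S_path le_i) isT.
  by case: (h (VR i)) => [t|j||t e] //= _; [lia | move=> -> | lia].
have Si := S_path (ltnW lt_i); have Si1 := S_path lt_i.
have : vedge (h (VR i)) (h (VR i.+1)) by apply: h_edge => //=.
have := hom_not_VG Si1 isT; have := h_valid Si1; rewrite Ei.
by case: (h (VR i.+1)) => [t|j||t e] //=; [lia | move=> _ _ /eqP-> | lia].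
Qed.

(** The image lies between [VR t] and [VR top]; [VR t.+1] is excluded by [t.+2 < top]. *)
Lemma hom_VV t : S (VV t) -> h (VV t) = VV t \/ exists2 e, e < d & h (VV t) = VW t e.
Proof.
move=> St; have /= lt_t := S_valid St.
have le_t : t <= top by rewrite /top /mid; lia.
have E1 : vedge (h (VR t)) (h (VV t)) by apply: h_edge => //=; apply: S_path.
have E2 : vedge (h (VV t)) (h (VR top)) by apply: h_edge => //=; apply: S_path.
rewrite hom_path // in E1; rewrite hom_path // in E2.
have := hom_not_VG St isT; have := h_valid St; move: E1 E2.
case: (h (VV t)) => [t'|j||t' e] //=.
- by move=> /eqP->; left.
- by move=> /eqP-> /eqP; rewrite /top /mid; lia.
- by move=> /eqP<- _ /andP[_ lt_e] _; right; exists e.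
Qed.

(** [VR t] determines the variable, and the path vertex reserved for the pair determines the
    value. *)
Lemma hom_VW t e : S (VW t e) -> h (VW t e) = VW t e.
Proof.
move=> St; have /= /andP[lt_t lt_e] := S_valid St.
have lt_o := offset_lt lt_t lt_e.
have le_t : t <= top by rewrite /top /mid; lia.
have le_o : mid + (t * d + e) <= top by rewrite /top; lia.
have E1 : vedge (h (VR t)) (h (VW t e)) by apply: h_edge => //=; apply: S_path.
have E2 : vedge (h (VW t e)) (h (VR (mid + (t * d + e)))).
  by apply: h_edge => //=; rewrite ?eqxx ?orbT //; apply: S_path.
rewrite hom_path // in E1; rewrite hom_path // in E2.
have := hom_not_VG St isT; move: E1 E2; rewrite /mid.
case: (h (VW t e)) => [t'|j||t' e'] //=.
- by move=> _ /eqP; lia.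
- by move=> /eqP-> /eqP; lia.
- by move=> /eqP<- /orP[/eqP|/eqP] H _; [lia | congr VW; lia].
Qed.

(** Any two variables are adjacent, but no variable is adjacent to a value. *)
Lemma hom_VV_all t t' : S (VV t) -> S (VV t') -> is_VW (h (VV t)) -> is_VW (h (VV t')).
Proof.
move=> St St' Wt; have [Et'|[e _ -> //]] := hom_VV St'.
have [lt_tt'|lt_t't|E] := ltngtP t t'; last by rewrite -E.
  have : vedge (h (VV t)) (h (VV t')) by apply: h_edge => /=.
  by rewrite Et'; case: (h (VV t)) Wt.
have : vedge (h (VV t')) (h (VV t)) by apply: h_edge => /=.
by rewrite Et'; case: (h (VV t)) Wt.
Qed.

Lemma hom_selectable : (forall t, t < m -> S (VV t)) ->
  (forall t, t < m -> is_VW (h (VV t))) -> selectable m d C.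
Proof.
move=> SV WV; pose s t := if h (VV t) is VW _ e then e else 0.
have hE t : t < m -> s t < d /\ h (VV t) = VW t (s t).
  move=> lt_t; have [E|[e lt_e E]] := hom_VV (SV t lt_t).
    by have := WV t lt_t; rewrite E.
  by rewrite /s E.
exists s; split=> [t /hE[]//|t t' lt_tt' lt_t'].
have lt_t := ltn_trans lt_tt' lt_t'.
have : vedge (h (VV t)) (h (VV t')) by apply: h_edge; rewrite ?SV.
by have [_ ->] := hE t lt_t; have [_ ->] := hE t' lt_t' => /= /andP[].
Qed.

End Rigidity.

Definition select_map (s : nat -> nat) (a : vertex) : vertex :=
  if a is VV t then VW t (s t) else a.

(** A value inherits all edges between its variable and the vertices [VR i], [VG]; only edges
    between variables require [C]. *)
Lemma select_map_edge s : (forall t t', t < t' -> t' < m -> C t (s t) t' (s t')) ->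
  forall a b, vvalid a -> vvalid b -> vedge a b ->
  vedge (select_map s a) (select_map s b).
Proof.
move=> Hs [t|i||t e] [t'|j||t' e'] //= lt_t lt_t'.
- by move=> lt_tt'; rewrite lt_tt' Hs.
- by move=> ->.
Qed.

Definition nverts : nat := m + (top.+1 + 1) + m * d.

(** Variables come first and values last, so that omitting either of them leaves an interval. *)
Definition vdecode (x : nat) : vertex :=
  if x < m then VV x else
  if x <= m + top then VR (x - m) else
  if x == m + top.+1 then VG else
  VW ((x - (m + top.+2)) %/ d) ((x - (m + top.+2)) %% d).

Definition vcode (a : vertex) : nat :=
  match a with
  | VV t => t
  | VR i => m + i
  | VG => m + top.+1
  | VW t e => m + top.+2 + (t * d + e)
  end.

Lemma vcodeK a : vvalid a -> vdecode (vcode a) = a.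
Proof.
case: a => [t|i||t e] /=; rewrite /vdecode.
- by move=> ->.
- move=> le_i; rewrite ifF; last by lia.
  by rewrite leq_add2l /top /mid le_i addKn.
- by move=> _; rewrite ltnNge leq_addr leq_add2l ltnn eqxx.
- case/andP=> lt_t lt_e; rewrite !ifF; try lia.
  by rewrite addKn divnMDl ?modnMDl ?divn_small ?modn_small ?addn0 //; lia.
Qed.

Lemma vdecodeK x : vcode (vdecode x) = x.
Proof.
rewrite /vdecode; case: ltnP => //= le_x; case: leqP => /= le_x'; first by lia.
by case: eqP => //= ne; rewrite -divn_eq; lia.
Qed.

Lemma vdecode_valid x : x < nverts -> vvalid (vdecode x).
Proof.
rewrite /nverts /vdecode => lt_x; case: ltnP => //= le_x.
case: leqP => /= le_x'; first by rewrite /top /mid in le_x'; lia.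
case: eqP => //= ne; have d_gt0 : 0 < d by case: (d) lt_x => //; rewrite muln0; lia.
by rewrite ltn_pmod // andbT ltn_divLR //; lia.
Qed.

Lemma vcode_lt a : vvalid a -> vcode a < nverts.
Proof.
rewrite /nverts; case: a => [t|i||t e] /=; rewrite -/mid -/top; try lia.
by case/andP=> lt_t lt_e; have := offset_lt lt_t lt_e; lia.
Qed.

Definition nedge (x y : nat) : bool := vedge (vdecode x) (vdecode y).

(** [VG] is a neighbour of all other vertices in both directions, and [VR 0] is one of [VG]. *)
Lemma nedge_total lo n : lo <= m -> m + top.+1 < lo + n ->
  forall x, lo <= x < lo + n -> x < nverts ->
  (exists2 y, lo <= y < lo + n & nedge x y) /\
  (exists2 y, lo <= y < lo + n & nedge y x).
Proof.
move=> le_lo lt_n x Hx lt_x.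
have Gv : vdecode (m + top.+1) = VG by rewrite -[RHS]vcodeK.
have R0 : vdecode m = VR 0 by rewrite -[RHS]vcodeK //= addn0.
rewrite /nedge; case Ex: (is_VG (vdecode x)).
  case: (vdecode x) Ex => // _.
  by split; exists m; rewrite ?R0 //; lia.
by split; exists (m + top.+1); rewrite ?Gv; try lia; case: (vdecode x) Ex.
Qed.

End Digraph.

(** * The instances of HOM and CORE *)

Section Instances.

Variables (m d : nat) (C : nat -> nat -> nat -> nat -> bool).
Hypothesis m_gt0 : 0 < m.

(** The number of path vertices plus one for [VG]. *)
Definition npath : nat := 2 * m + m * d + 3.

Local Notation E := (nedge m d C).
Local Notation lab := (fun i => nat_of_bool (odd i)).

Lemma vcode_geq a : ~~ is_VV a -> m <= vcode m d a.
Proof. by case: a => [t|i||t e] //= _; lia. Qed.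

Lemma vcode_npath a : vvalid m d a -> ~~ is_VW a -> vcode m d a < m + npath.
Proof. by rewrite /npath; case: a => [t|i||t e] //=; lia. Qed.

Lemma nvertsE : nverts m d = m + npath + m * d.
Proof. by rewrite /nverts /npath; lia. Qed.

Lemma select_map_valid s a : (forall t, t < m -> s t < d) ->
  vvalid m d a -> vvalid m d (select_map s a).
Proof. by case: a => [t|i||t e] //= Hs lt_t; rewrite lt_t Hs. Qed.

Definition select_num s x : nat := vcode m d (select_map s (vdecode m d x)).

Lemma select_num_range s x : (forall t, t < m -> s t < d) ->
  x < nverts m d -> m <= select_num s x < nverts m d.
Proof.
move=> Hs lt_x; rewrite vcode_geq /=; last by case: (vdecode m d x).
by apply: (vcode_lt m_gt0); apply: select_map_valid => //; apply: (vdecode_valid m_gt0).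
Qed.

Lemma select_num_edge s x y : (forall t, t < m -> s t < d) ->
  (forall t t', t < t' -> t' < m -> C t (s t) t' (s t')) ->
  x < nverts m d -> y < nverts m d -> E x y ->
  E (select_num s x) (select_num s y).
Proof.
move=> Hs HC lt_x lt_y; have vx := vdecode_valid m_gt0 lt_x; have vy := vdecode_valid m_gt0 lt_y.
by rewrite /nedge !vcodeK ?select_map_valid //; apply: select_map_edge.
Qed.

Lemma hom_instance :
  (exists h, data_hom (4 * (m + npath)) (block_rel E 0) lab
               (4 * (npath + m * d)) (block_rel E m) lab h) <->
  selectable m d C.
Proof.
have tot := @nedge_total m d C m_gt0 0 (m + npath) isT.
have Htot x : 0 <= x < 0 + (m + npath) -> 
    (exists2 y, 0 <= y < 0 + (m + npath) & E x y) /\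
    (exists2 y, 0 <= y < 0 + (m + npath) & E y x).
  by move=> Hx; apply: tot => //; rewrite ?nvertsE /npath in Hx *; lia.
split=> [[h Hh]|[s [Hs HC]]]; last first.
  eexists; apply: (block_hom_of (g := select_num s)).
    move=> x Hx; have := @select_num_range s x Hs; rewrite nvertsE; lia.
  by move=> x y Hx Hy; apply: select_num_edge => //; rewrite nvertsE; lia.
have [g [g_range g_edge _]] := block_hom_to (fun x Hx => (Htot x Hx).1)
  (fun x Hx => (Htot x Hx).2) Hh.
pose S a := vvalid m d a && ~~ is_VW a.
pose f a := vdecode m d (g (vcode m d a)).
have S_lt a : S a -> 0 <= vcode m d a < 0 + (m + npath).
  by case/andP=> va wa; apply: vcode_npath.
have S_valid a : S a -> vvalid m d a by case/andP.
have S_path i : i <= 2 * m + 1 + m * d -> S (VR i) by move=> le_i; rewrite /S /= le_i.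
have f_valid a : S a -> vvalid m d (f a).
  by move=> /S_lt/g_range Ha; apply: (vdecode_valid m_gt0); rewrite nvertsE; lia.
have f_edge a b : S a -> S b -> vedge m d C a b -> vedge m d C (f a) (f b).
  move=> Sa Sb Eab; apply: (g_edge _ _ (S_lt _ Sa) (S_lt _ Sb)).
  by rewrite /nedge !vcodeK // S_valid.
apply: (hom_selectable m_gt0 S_valid S_path _ f_valid f_edge) => // t lt_t.
  by rewrite /S /= lt_t.
have St : S (VV t) by rewrite /S /= lt_t.
have [Et|[e _ -> //]] := hom_VV m_gt0 S_valid S_path isT f_valid f_edge St.
have /andP[le_m _] := g_range _ (S_lt _ St).
move: Et; rewrite /f /vdecode ltnNge le_m /=.
by case: ifP => //; case: ifP.
Qed.

Lemma core_instance :
  (exists2 h, data_hom (4 * nverts m d) (block_rel E 0) lab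
               (4 * nverts m d) (block_rel E 0) lab h &
     exists2 y, y < 4 * nverts m d & forall x, x < 4 * nverts m d -> h x <> y) <->
  selectable m d C.
Proof.
have Htot x : 0 <= x < 0 + nverts m d ->
    (exists2 y, 0 <= y < 0 + nverts m d & E x y) /\
    (exists2 y, 0 <= y < 0 + nverts m d & E y x).
  move=> Hx; apply: nedge_total => //; rewrite nvertsE /npath; lia.
split=> [[h Hh [y lt_y Hy]]|[s [Hs HC]]]; last first.
  eexists; first apply: (block_hom_of (g := select_num s)).
  - by move=> x Hx; have := @select_num_range s x Hs Hx; lia.
  - by move=> x y Hx Hy; apply: select_num_edge.
  (* The element 0 belongs to the variable [VV 0], whereas all images lie at vertices numbered [m]
     or more. *)
  exists 0; first by rewrite nvertsE; lia.
  move=> x lt_x; have lt_x' : x %/ 4 < nverts m d by rewrite ltn_divLR // mulnC.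
  have := select_num_range Hs lt_x'; rewrite add0n; lia.
have [g [g_range g_edge hE]] := block_hom_to (fun x Hx => (Htot x Hx).1)
  (fun x Hx => (Htot x Hx).2) Hh.
pose f a := vdecode m d (g (vcode m d a)).
have S_valid a : vvalid m d a -> vvalid m d a by [].
have S_lt a : vvalid m d a -> 0 <= vcode m d a < 0 + nverts m d.
  by move=> va; apply: (vcode_lt m_gt0).
have S_path i : i <= 2 * m + 1 + m * d -> vvalid m d (VR i) by [].
have f_valid a : vvalid m d a -> vvalid m d (f a).
  by move=> /S_lt/g_range Ha; apply: (vdecode_valid m_gt0).
have f_edge a b : vvalid m d a -> vvalid m d b -> vedge m d C a b ->
    vedge m d C (f a) (f b).
  move=> Sa Sb Eab; apply: (g_edge _ _ (S_lt _ Sa) (S_lt _ Sb)).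
  by rewrite /nedge !vcodeK.
apply: (hom_selectable m_gt0 S_valid S_path _ f_valid f_edge) => // t lt_t.
(* One moved variable makes all of them move. If none moves, every vertex is fixed and [h] is the
   identity, so [y] is attained. *)
have [/has_iotaP[t' lt_t' Wt']|/hasPn H] :=
    boolP (has (fun t => is_VW (f (VV t))) (iota 0 m)).
  exact: (hom_VV_all m_gt0 S_valid S_path isT f_valid f_edge (t := t')).
have fE a : vvalid m d a -> f a = a.
  case: a => [t'|i||t' e] va.
  - have [//|[e _ Et']] := hom_VV m_gt0 S_valid S_path isT f_valid f_edge va.
    by have := H t'; rewrite Et' mem_iota /= => /(_ va).
  - exact: (hom_path m_gt0 S_path isT f_valid f_edge).
  - exact: (hom_VG m_gt0 S_path isT f_valid f_edge).
  - exact: (hom_VW m_gt0 S_valid S_path isT f_valid f_edge).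
case: (Hy y lt_y); rewrite hE // add0n.
have lt_y' : y %/ 4 < nverts m d by rewrite ltn_divLR // mulnC.
have := fE _ (vdecode_valid m_gt0 lt_y'); rewrite /f vdecodeK //.
move/(congr1 (vcode m d)); rewrite !vdecodeK // => ->.
by rewrite subn0 mulnC -divn_eq.
Qed.

End Instances.

(** * Runs as pairwise compatible values *)

Section TapeContents.

Variable A : Type.
Implicit Type tp : tape A.

(* The letter at position [p] when the head is at position [h]. *)
Definition tcell tp (h p : nat) : cell A :=
  if p < h then nth None (tleft tp) (h - p.+1)
  else nth None (thead tp :: tright tp) (p - h).

Definition shift (mv : move) (h : nat) : nat :=
  match mv with MoveLeft => h.-1 | Stay => h | MoveRight => h.+1 end.

Lemma tcell_head tp h : tcell tp h h = thead tp.
Proof. by rewrite /tcell ltnn subnn. Qed.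

Lemma tcell_write a tp h p :
  tcell (tape_write a tp) h p = if p == h then a else tcell tp h p.
Proof.
rewrite /tcell /=; case: ltngtP => // [lt_hp|->]; last by rewrite subnn.
by case: (p - h) (subn_gt0 h p) => //=; rewrite lt_hp.
Qed.

Lemma tcell_move mv tp h p : 0 < h ->
  tcell (tape_move mv tp) (shift mv h) p = tcell tp h p.
Proof.
case: h => // h _; case: tp => l a r; case: mv => //=; rewrite /tcell /=.
- case: (ltngtP p h) => [lt_ph|lt_hp|->].
  + rewrite ltnS (ltnW lt_ph) nth_behead; congr nth; lia.
  + by rewrite ltnS leqNgt lt_hp /= -subSS subSn.
  + by rewrite ltnSn !subnn nth0.
- case: (ltngtP p h.+1) => [lt_ph|lt_hp|->].
  + by rewrite ltnS (ltnW lt_ph) subSn.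
  + rewrite ltnS leqNgt lt_hp /=.
    have -> : p - h.+1 = (p - h.+2).+1 by lia.
    by case: r => [|b r] /=; case: (p - h.+2) => [|[|k]].
  + by rewrite ltnSn !subnn.
Qed.

End TapeContents.

Lemma tcell_word (A : Type) (w : word) h p :
  tcell (tape_of_word A w) h p =
  if p < h then None else nth None [seq Some (inl b) | b <- w] (p - h).
Proof.
rewrite /tcell /tape_of_word /=; case: ltnP => _; first by rewrite nth_nil.
by case: w => [|b w] //=; case: (p - h) => //= k; rewrite nth_nil.
Qed.

Section Memory.

Variables (T : Type) (f : nat -> nat -> T) (h : nat -> nat) (wr : nat -> T).

(* [l] codes the last time before [t] at which the head was where it is at time
   [t], with 0 for never and [t'.+1] for the time [t']. *)
Lemma memory_last t l : l <= t ->
  (forall t' p, t' < t -> f t'.+1 p = if p == h t' then wr t' else f t' p) ->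
  (forall t', t' < t -> l = t'.+1 -> h t' = h t) ->
  (forall t', t' < t -> l < t'.+1 -> h t' <> h t) ->
  f t (h t) = if l is t'.+1 then wr t' else f 0 (h t).
Proof.
move=> le_lt Hf Hl Hgt.
suff H k : l <= k -> k <= t -> f k (h t) = if l is t'.+1 then wr t' else f 0 (h t).
  exact: H.
elim: k => [|k IH]; first by rewrite leqn0 => /eqP->.
rewrite leq_eqVlt => /orP[/eqP El|lt_lk] lt_kt.
  by rewrite El Hf // (Hl k) // eqxx.
by rewrite Hf // ifN ?IH // 1?ltnW //; apply/eqP => E; apply: (Hgt k).
Qed.

End Memory.

(** Follows the convention of [memory_last]: 0 for never, [t'.+1] for the time [t']. *)
Fixpoint last_time (p : pred nat) (t : nat) : nat :=
  if t is t'.+1 then if p t' then t else last_time p t' else 0.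

Lemma last_time_leq p t : last_time p t <= t.
Proof. by elim: t => //= t IH; case: ifP => // _; apply: leqW. Qed.

Lemma last_timeP p t t' : last_time p t = t'.+1 -> p t'.
Proof. by elim: t => //= t IH; case: ifP => // pt [<-]. Qed.

Lemma last_time_max p t t' : t' < t -> last_time p t < t'.+1 -> ~~ p t'.
Proof.
elim: t => //= t IH; rewrite ltnS leq_eqVlt => /orP[/eqP->|lt_t't].
  by case: ifP => [_|_] //; rewrite ltnn.
by case: ifP => [_|_]; [lia | apply: IH].
Qed.

Lemma digits_exist (H : nat) (g : nat -> nat) K : 0 < H -> (forall j, j < K -> g j < H) ->
  exists2 e, e < H ^ K & forall j, j < K -> e %/ H ^ j %% H = g j.
Proof.
move=> H0; elim: K g => [|K IH] g Hg; first by exists 0.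
have [|e lt_e He] := IH (fun j => g j.+1); first by move=> j lt_j; apply: Hg.
have g0 : g 0 < H by apply: Hg.
exists (e * H + g 0).
  rewrite expnS; apply: (@leq_trans (e.+1 * H)); first by rewrite mulSn; lia.
  by rewrite mulnC leq_mul2l lt_e orbT.
move=> [|j] lt_j; first by rewrite expn0 divn1 modnMDl modn_small.
by rewrite expnS divnMA divnMDl // (divn_small g0) addn0 He.
Qed.

(** * Views of a machine and the constraints on them *)

Section Tableau.

Variable M : tm.

Local Notation n := (tm_work M).+2.
Local Notation Cell := (option (bool + tm_sym M)).
Local Notation View := (tm_state M * {ffun 'I_n -> Cell})%type.

Definition views : nat := #|{: View}|.

Definition view0 : View := (tm_start M, [ffun => None]).

Definition view (z : nat) : View := nth view0 (enum {: View}) z.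

Definition view_code (v : View) : nat := index v (enum {: View}).

Lemma view_code_lt v : view_code v < views.
Proof. by rewrite /views cardE index_mem mem_enum. Qed.

Lemma view_codeK v : view (view_code v) = v.
Proof. by rewrite /view nth_index // mem_enum. Qed.

(** Halted states idle, which makes every step uniform. *)
Definition transition (v : View) : tm_state M * {ffun 'I_n -> cell (tm_sym M) * move} :=
  if tm_final v.1 then (v.1, [ffun i => (v.2 i, Stay)]) else tm_trans v.1 v.2.

Definition config_view (c : config M) : View :=
  (cstate c, [ffun i => thead (ctapes c i)]).

Lemma tm_stepE (c : config M) : tm_step c =
  Config (transition (config_view c)).1
    (fun i => tape_move ((transition (config_view c)).2 i).2
       (tape_write ((transition (config_view c)).2 i).1 (ctapes c i))).
Proof.
rewrite /tm_step /halted /transition /=; case: ifP => _; last by case: tm_trans.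
case: c => q T /=; congr Config; apply: functional_extensionality => i.
by rewrite !ffunE /=; case: (T i).
Qed.

(** The machine enters the constraints only through functions of the code [z] of a view, which are
    finite tables for fixed [M]. *)
Definition state_code z : nat := enum_rank (view z).1.
Definition next_code z : nat := enum_rank (transition (view z)).1.
Definition sym_code i z : nat := enum_rank ((view z).2 i).
Definition write_code i z : nat := enum_rank (((transition (view z)).2 i).1 : Cell).
Definition goes_left i z : bool :=
  if ((transition (view z)).2 i).2 is MoveLeft then true else false.
Definition goes_right i z : bool :=
  if ((transition (view z)).2 i).2 is MoveRight then true else false.
Definition reads_blank i z : bool := (view z).2 i == None.
Definition reads_bit b i z : bool := (view z).2 i == Some (inl b).
Definition starts z : bool := (view z).1 == tm_start M.
Definition accepts z : bool := reads_bit true ord0 z.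

Section Constraints.

(* [q] bounds the length of the certificate and [T] the running time. Heads
   start at position [T], so that no position visited is negative. *)
Variables (x : word) (q T : nat).

(** Exceeds all digits: head positions are at most [2 * T], coded times at most [T], lengths at most
    [q]. *)
Definition base : nat := 2 * T + q + 3.
Definition ndigits : nat := 2 * n + 1.
Definition nvalues : nat := views * base ^ ndigits.

(* A value for time [t] is a number [e] coding the state and the letters read at
   time [t], the length of the certificate and, for every tape, the position of
   the head and the last earlier time at which it was there. *)
Definition vview (e : nat) : nat := e %% views.
Definition vdigit (j e : nat) : nat := e %/ views %/ base ^ j %% base.
Definition vlen (e : nat) : nat := vdigit 0 e.
Definition vhead (i : 'I_n) (e : nat) : nat := vdigit (2 * i + 1) e.
Definition vlast (i : 'I_n) (e : nat) : nat := vdigit (2 * i + 2) e.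

(** Restricts the letter read at a first visit. On tape 1 any bit is allowed within the length of
    the certificate, which is how the certificate is guessed. *)
Definition initial_ok (i : 'I_n) (e : nat) : bool :=
  let h := vhead i e in let z := vview e in
  match nat_of_ord i with
  | 0 => if (T <= h) && (h - T < size x)
         then if nth false x (h - T) then reads_bit true i z else reads_bit false i z
         else reads_blank i z
  | 1 => if (T <= h) && (h - T < vlen e)
         then reads_bit true i z || reads_bit false i z
         else reads_blank i z
  | _ => reads_blank i z
  end.

Definition unary_ok (t e : nat) : bool :=
  [&& (t == 0) ==> starts (vview e) && all (fun i => vhead i e == T) (enum 'I_n),
      (t == T) ==> accepts (vview e),
      vlen e <= q,
      all (fun i => vlast i e <= t) (enum 'I_n)
    & all (fun i => (vlast i e == 0) ==> initial_ok i e) (enum 'I_n)].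

Definition binary_ok (t e t' e' : nat) : bool :=
  [&& vlen e == vlen e',
      (t' == t.+1) ==> (next_code (vview e) == state_code (vview e')) &&
        (* The move to the left is added on the other side to avoid truncated subtraction. *)
        all (fun i => vhead i e' + goes_left i (vview e) ==
                      vhead i e + goes_right i (vview e)) (enum 'I_n),
      all (fun i => (vlast i e' == t.+1) ==>
        (vhead i e == vhead i e') &&
        (write_code i (vview e) == sym_code i (vview e'))) (enum 'I_n)
    & all (fun i => (vlast i e' < t.+1) ==> (vhead i e != vhead i e')) (enum 'I_n)].

(** [selectable] tests pairs only, so the unary conditions ride along; for [0 < T] every time occurs
    in a pair. *)
Definition compatible (t e t' e' : nat) : bool :=
  [&& unary_ok t e, unary_ok t' e' & binary_ok t e t' e'].

Section Trace.

Variable u : word.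

Definition trace (t : nat) : config M := iter t (@tm_step M) (tm_init M x u).

Definition tview (t : nat) : View := config_view (trace t).

Lemma traceS t : trace t.+1 = Config (transition (tview t)).1
    (fun i => tape_move ((transition (tview t)).2 i).2
       (tape_write ((transition (tview t)).2 i).1 (ctapes (trace t) i))).
Proof. exact: tm_stepE. Qed.

Fixpoint hpos (i : 'I_n) (t : nat) : nat :=
  if t is t'.+1 then shift ((transition (tview t')).2 i).2 (hpos i t') else T.

Definition contents (i : 'I_n) (t p : nat) : cell (tm_sym M) :=
  tcell (ctapes (trace t) i) (hpos i t) p.

(** Before time [T] positions are positive, so the predecessor in [shift] never truncates. *)
Lemma hpos_bounds i t : t <= T -> T - t <= hpos i t <= T + t.
Proof.
elim: t => [|t IH] lt_t /=; first by rewrite subn0 addn0 leqnn.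
by have := IH (ltnW lt_t); case: (_.2) => /=; lia.
Qed.

Lemma contents_head i t : contents i t (hpos i t) = (tview t).2 i.
Proof. by rewrite /contents tcell_head ffunE. Qed.

Lemma contents_step i t p : t < T ->
  contents i t.+1 p =
  if p == hpos i t then ((transition (tview t)).2 i).1 else contents i t p.
Proof.
move=> lt_t; rewrite /contents traceS /=.
rewrite tcell_move ?tcell_write //.
by have := hpos_bounds i (ltnW lt_t); lia.
Qed.

Lemma contents0 i p : contents i 0 p =
  if p < T then None
  else nth None [seq Some (inl b) | b <- nth [::] [:: x; u] i] (p - T).
Proof. by rewrite /contents /= tcell_word. Qed.

Lemma tview_state t : (tview t.+1).1 = (transition (tview t)).1.
Proof. by rewrite {1}/tview traceS. Qed.

End Trace.

Lemma nth_word (w : word) k :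
  nth None [seq Some (inl b) | b <- w] k =
  if k < size w then Some (inl (nth false w k) : bool + tm_sym M) else None.
Proof.
case: ltnP => [lt_k|le_k]; first by rewrite (nth_map false).
by rewrite nth_default // size_map.
Qed.

Lemma views_gt0 : 0 < views.
Proof. exact: leq_ltn_trans (view_code_lt view0). Qed.

Lemma value_exists z (g : nat -> nat) : z < views ->
  (forall j, j < ndigits -> g j < base) ->
  exists2 e, e < nvalues & vview e = z /\ forall j, j < ndigits -> vdigit j e = g j.
Proof.
move=> lt_z Hg; have b0 : 0 < base by rewrite /base; lia.
have [e lt_e He] := digits_exist b0 Hg.
exists (e * views + z).
  apply: (@leq_trans (e.+1 * views)); first by rewrite mulSn; lia.
  by rewrite /nvalues [views * _]mulnC leq_mul2r lt_e orbT.
split; first by rewrite /vview modnMDl modn_small.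
by move=> j lt_j; rewrite /vdigit divnMDl ?views_gt0 // (divn_small lt_z) addn0 He.
Qed.

Lemma tableau_complete u : size u <= q ->
  (tview u T).2 ord0 = Some (inl true) -> selectable T.+1 nvalues compatible.
Proof.
move=> le_u acc.
pose lv i t := last_time (fun t' => hpos u i t' == hpos u i t) t.
pose g t j := if j is j'.+1 then
    if odd j' then lv (inord j'./2) t else hpos u (inord j'./2) t
  else size u.
have Hg t : t <= T -> forall j, j < ndigits -> g t j < base.
  move=> le_t [|j] _ /=; rewrite /base; first by lia.
  case: ifP => _; first by rewrite /lv; have := last_time_leq
    (fun t' => hpos u (inord j./2) t' == hpos u (inord j./2) t) t; lia.
  by have := hpos_bounds u (inord j./2) le_t; lia.
(* The implication makes this satisfiable for every [t], and [xchoose] then yields a total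
   function. *)
have ex t : exists e, (t <= T) ==> [&& e < nvalues, vview e == view_code (tview u t)
    & all (fun j => vdigit j e == g t j) (iota 0 ndigits)].
  case: leqP => // le_t; last by exists 0.
  have [e lt_e [Ez Ed]] := value_exists (view_code_lt (tview u t)) (Hg t le_t).
  by exists e; rewrite lt_e Ez eqxx implyTb !andTb; apply/all_iotaP => j /Ed->.
pose s t := xchoose (ex t).
have sP t : t <= T -> [/\ s t < nvalues, view (vview (s t)) = tview u t,
    vlen (s t) = size u, forall i, vhead i (s t) = hpos u i t
    & forall i, vlast i (s t) = lv i t].
  move=> le_t; have := xchooseP (ex t); rewrite -/(s t) le_t implyTb.
  case/and3P=> lt_s /eqP Ez /all_iotaP Ed; split=> //.
  - by rewrite Ez view_codeK.
  - exact/eqP/Ed.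
  - move=> i; have lt_i := ltn_ord i.
    have -> : vhead i (s t) = g t (2 * i + 1) by apply/eqP/Ed; rewrite /ndigits; lia.
    by rewrite addn1 /= mul2n odd_double doubleK inord_val.
  - move=> i; have lt_i := ltn_ord i.
    have -> : vlast i (s t) = g t (2 * i + 2) by apply/eqP/Ed; rewrite /ndigits; lia.
    by rewrite addn2 /= mul2n odd_double /= uphalf_double inord_val.
have sym_val t i : t <= T -> (view (vview (s t))).2 i = contents u i t (hpos u i t).
  by move=> le_t; have [_ -> _ _ _] := sP t le_t; rewrite contents_head.
have mem t i : t <= T -> contents u i t (hpos u i t) =
    if lv i t is t'.+1 then ((transition (tview u t')).2 i).1
    else contents u i 0 (hpos u i t).
  move=> le_t; apply: (memory_last (f := contents u i) (h := hpos u i)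
    (wr := fun t => ((transition (tview u t)).2 i).1)).
  - exact: last_time_leq.
  - by move=> t' p lt_t'; apply: contents_step; apply: leq_trans le_t.
  - by move=> t' _ /last_timeP/eqP.
  - by move=> t' lt_t' /(last_time_max lt_t')/eqP.
have unary t : t <= T -> unary_ok t (s t).
  move=> le_t; have [_ Ev Eu Eh El] := sP t le_t.
  apply/and5P; split.
  - apply/implyP => /eqP t0; rewrite t0 in Ev Eh *; rewrite /starts Ev eqxx /=.
    by apply/allP => i _; rewrite Eh.
  - by apply/implyP => /eqP tT; rewrite /accepts /reads_bit Ev tT acc.
  - by rewrite Eu.
  - by apply/allP => i _; rewrite El last_time_leq.
  apply/allP => i _; apply/implyP; rewrite El => /eqP l0.
  have := mem t i le_t; rewrite l0 -sym_val // contents0 nth_word => Es.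
  rewrite /initial_ok /reads_blank /reads_bit Es Eh Eu.
  case: (nat_of_ord i) => [|[|k]] /=.
  - rewrite [hpos u i t < T]ltnNge; case: (T <= _) => //=; case: (_ < size x) => //=.
    by case: nth; rewrite /= ?eqxx.
  - rewrite [hpos u i t < T]ltnNge; case: (T <= _) => //=; case: (_ < size u) => //=.
    by case: nth; rewrite /= ?eqxx ?orbT.
  - by rewrite nth_nil /= if_same.
exists s; split=> [t|t t' lt_tt' lt_t']; first by rewrite ltnS => /sP[].
have le_t' : t' <= T by rewrite -ltnS.
have lt_tT : t < T by apply: leq_trans le_t'.
have le_t := ltnW lt_tT.
have [_ Ev Eu Eh El] := sP t le_t; have [_ Ev' Eu' Eh' El'] := sP t' le_t'.
rewrite /compatible !unary //=; apply/and4P; split.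
- by rewrite Eu Eu'.
- apply/implyP => /eqP Et'; rewrite /next_code /state_code Ev Ev' {1}Et' tview_state eqxx /=.
  apply/allP => i _; rewrite Eh Eh' Et' /= /goes_left /goes_right Ev.
  have := hpos_bounds u i le_t; case: (_.2) => /=; lia.
- apply/allP => i _; rewrite El' Eh Eh'; apply/implyP => /eqP lvE.
  rewrite (last_timeP lvE) /write_code /sym_code; apply/eqP; congr (nat_of_ord (enum_rank _)).
  by rewrite sym_val // mem // lvE Ev.
- apply/allP => i _; rewrite El' Eh Eh'; apply/implyP.
  exact: last_time_max.
Qed.

Lemma tableau_sound : 0 < T -> selectable T.+1 nvalues compatible ->
  exists2 u, size u <= q & (tview u T).2 ord0 = Some (inl true).
Proof.
move=> T0 [s [_ HC]].
have HU t : t <= T -> unary_ok t (s t).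
  case: t => [|t] le_t; first by have /and3P[] := HC 0 1 isT T0.
  by have /and3P[] := HC 0 t.+1 isT le_t.
have HB t t' : t < t' -> t' <= T -> binary_ok t (s t) t' (s t').
  by move=> lt_tt' le_t'; have /and3P[] := HC t t' lt_tt' le_t'.
pose i1 : 'I_n := inord 1.
have i1E : nat_of_ord i1 = 1 by rewrite inordK.
(* Bit [j] of the certificate is the one read at the first visit to position [T + j] of tape 1, and
   [false] if there is none. *)
pose first_read j t := [&& vlast i1 (s t) == 0, vhead i1 (s t) == T + j
  & reads_bit true i1 (vview (s t))].
pose u := mkseq (fun j => has (first_read j) (iota 0 T.+1)) (vlen (s 0)).
have len_eq t : t <= T -> vlen (s t) = vlen (s 0).
  by case: t => // t le_t; have /and4P[/eqP-> _ _ _] := HB 0 t.+1 isT le_t.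
have le_u : size u <= q by rewrite size_mkseq; have /and5P[] := HU 0 isT.
have eq_vhead t t' i : t < t' -> t' <= T -> vlast i (s t') = 0 ->
    vhead i (s t) <> vhead i (s t').
  move=> lt_tt' le_t' l0; have /and4P[_ _ _ /allP H] := HB t t' lt_tt' le_t'.
  by apply/eqP; have := H i (mem_enum _ _); rewrite l0.
(* Of two first visits to one position, the later would have an earlier visit before it, against
   [eq_vhead]. *)
have bit_unique t j : t <= T -> vlast i1 (s t) = 0 -> vhead i1 (s t) = T + j ->
    has (first_read j) (iota 0 T.+1) = reads_bit true i1 (vview (s t)).
  move=> le_t l0 hE; apply/has_iotaP/idP => [[t' lt_t' /and3P[/eqP l0' /eqP hE' rd]]|rd].
    have [lt|lt|<- //] := ltngtP t' t.
      by case: (eq_vhead _ _ i1 lt le_t l0); rewrite hE hE'.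
    by case: (eq_vhead _ _ i1 lt lt_t' l0'); rewrite hE hE'.
  by exists t => //; rewrite /first_read l0 hE !eqxx.
have init t i : t <= T -> vlast i (s t) = 0 ->
    contents u i 0 (vhead i (s t)) = (view (vview (s t))).2 i.
  move=> le_t l0; have /and5P[_ _ _ _ /allP H] := HU t le_t.
  have := H i (mem_enum _ _); rewrite l0 /= contents0 nth_word /initial_ok.
  case E: (nat_of_ord i) => [|[|k]] /=.
  - rewrite [vhead i (s t) < T]ltnNge; case: (T <= _) => /=; last by move/eqP.
    case: (_ < size x) => /=; last by move/eqP.
    by case: nth => /eqP.
  - have Ei : i = i1 by apply: val_inj; rewrite /= E i1E.
    rewrite len_eq // size_mkseq [vhead i (s t) < T]ltnNge.
    case: (leqP T) => /= le_T; last by move/eqP.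
    case: ltnP => /= lt_k; last by move/eqP.
    rewrite nth_mkseq // (bit_unique t) -?Ei ?subnKC //.
    by rewrite /reads_bit; case: eqP => [->|_ /= /eqP ->].
  - by rewrite nth_nil /= if_same => /eqP.
(* Strong induction, as a letter may have been written at any earlier time. *)
have main t : t <= T -> forall t', t' <= t ->
    view (vview (s t')) = tview u t' /\ forall i, vhead i (s t') = hpos u i t'.
  elim: t => [|t IH] le_t t'.
    rewrite leqn0 => /eqP->; have /and5P[H0 _ _ /allP Hl _] := HU 0 le_t.
    have /andP[/eqP Hs /allP Hh] := implyP H0 isT.
    have Eh i : vhead i (s 0) = T by apply/eqP/Hh/mem_enum.
    split=> //; rewrite [LHS]surjective_pairing Hs; congr pair.
    apply/ffunP => i; rewrite -[RHS]contents_head -init ?Eh //.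
    by apply/eqP; rewrite -leqn0 Hl ?mem_enum.
  rewrite leq_eqVlt => /orP[/eqP->|]; last by rewrite ltnS; apply: IH; apply: ltnW.
  have {}IH := IH (ltnW le_t).
  have [Ev Eh] := IH t (leqnn t).
  have /and4P[_ /implyP/(_ (eqxx _))/andP[/eqP Hq /allP Hh] _ _] := HB t t.+1 (ltnSn t) le_t.
  have Eh' i : vhead i (s t.+1) = hpos u i t.+1.
    have := hpos_bounds u i (ltnW le_t).
    have /eqP := Hh i (mem_enum _ _); rewrite Eh /goes_left /goes_right Ev /=.
    by case: (_.2) => /=; lia.
  split=> //; rewrite [LHS]surjective_pairing [RHS]surjective_pairing; congr pair.
    rewrite tview_state -Ev; apply: enum_rank_inj; apply: val_inj.
    by symmetry; exact: Hq.
  apply/ffunP => i; rewrite -contents_head.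
  have /and5P[_ _ _ /allP Hl _] := HU t.+1 le_t.
  have le_l : vlast i (s t.+1) <= t.+1 by apply: Hl; rewrite mem_enum.
  rewrite (memory_last (f := contents u i) (h := hpos u i)
    (wr := fun t => ((transition (tview u t)).2 i).1) le_l).
  - case El: (vlast i (s t.+1)) => [|l]; first by rewrite -Eh' init.
    have lt_l : l < t.+1 by rewrite -El.
    have [Evl Ehl] := IH l lt_l.
    have /and4P[_ _ /allP H3 _] := HB l t.+1 lt_l le_t.
    have := H3 i (mem_enum _ _); rewrite El eqxx /= => /andP[_ /eqP Ew].
    rewrite -Evl; apply: enum_rank_inj; apply: val_inj; symmetry; exact: Ew.
  - by move=> t'' p lt_t''; apply: contents_step; apply: leq_trans le_t.
  - move=> t'' lt_t'' El; have [_ Ehl] := IH t'' lt_t''.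
    have /and4P[_ _ /allP H3 _] := HB t'' t.+1 lt_t'' le_t.
    have := H3 i (mem_enum _ _); rewrite El eqxx /= => /andP[/eqP Eq _].
    by rewrite -Ehl Eq; apply: Eh'.
  - move=> t'' lt_t'' lt_l; have [_ Ehl] := IH t'' lt_t''.
    have /and4P[_ _ _ /allP H4] := HB t'' t.+1 lt_t'' le_t.
    have := H4 i (mem_enum _ _); rewrite lt_l /= => /eqP Eq.
    by rewrite -Ehl => El; apply: Eq; rewrite El; symmetry; apply: Eh'.
exists u => //; have [Ev _] := main T (leqnn T) T (leqnn T).
have /and5P[_ /implyP/(_ (eqxx _))/eqP HT _ _ _] := HU T (leqnn T).
by rewrite -Ev.
Qed.

End Constraints.

End Tableau.

(** * NP-hardness *)

Lemma horner_nat_mono (p : {poly nat}) a b : a <= b -> (p.[a])%R <= (p.[b])%R.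
Proof.
move=> le_ab; elim/poly_ind: p => [|p c IH]; first by rewrite !hornerC.
by rewrite !hornerMXaddC; apply: leq_add => //; apply: leq_mul.
Qed.

Lemma data_hom_ext n r c n' r' c' s d s' d' h :
  (forall i j, i < n -> j < n -> r i j = s i j) -> (forall i, i < n -> c i = d i) ->
  (forall i j, i < n' -> j < n' -> r' i j = s' i j) ->
  (forall i, i < n' -> c' i = d' i) ->
  data_hom n r c n' r' c' h -> data_hom n s d n' s' d' h.
Proof.
move=> Hr Hc Hr' Hc' [H1 H2]; split=> [i lt_i|i j lt_i lt_j].
  by have [lt_h E] := H1 i lt_i; rewrite -Hc // -Hc'.
have [lt_hi _] := H1 i lt_i; have [lt_hj _] := H1 j lt_j.
by rewrite -Hr // -Hr' //; apply: H2.
Qed.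

(** By unique readability, any instance with this code has the same data. *)
Lemma kHOM_code k n r c n' r' c' :
  poset_data k n r c -> poset_data k n' r' c' ->
  kHOM k (poset_code n r c ++ poset_code n' r' c') <->
  exists h, data_hom n r c n' r' c' h.
Proof.
move=> D D'; rewrite kHOM_data; split=> [|[h Hh]]; last first.
  by exists n, r, c, n', r', c'; split=> //; exists h.
case=> [a [s [e [a' [s' [e' [E _ _ [h Hh]]]]]]]]; exists h.
have [Ea Hs He E'] := poset_code_inj E.
move: E'; rewrite -[poset_code n' r' c']cats0 -[poset_code a' s' e']cats0.
case/poset_code_inj => Ea' Hs' He' _; subst a a'.
by apply: data_hom_ext Hh => *; apply/esym; auto.
Qed.

Lemma kCORE_code k n r c : poset_data k n r c ->
  kCORE k (poset_code n r c) <->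
  exists2 h, data_hom n r c n r c h & exists2 y, y < n & forall x, x < n -> h x <> y.
Proof.
move=> D; rewrite kCORE_data; split=> [|Hh]; last by exists n, r, c.
case=> [a [s [e [E _ [h Hh Hy]]]]]; exists h.
  move: E; rewrite -[poset_code n r c]cats0 -[poset_code a s e]cats0.
  case/poset_code_inj => Ea Hs He _; subst a.
  by apply: data_hom_ext Hh => *; apply/esym; auto.
move: E; rewrite -[poset_code n r c]cats0 -[poset_code a s e]cats0.
by case/poset_code_inj => -> _ _ _.
Qed.

(** * The reductions and their computation in polynomial time *)

Section Acceptance.

Variables (M : tm) (v : word -> word -> bool) (p q : {poly nat}).
Hypothesis Mv : forall x u, returns_within M (p.[(size x + size u)%N])%R x u [:: v x u].

Definition cert_bound (x : word) : nat := (q.[size x])%R.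
(** The successor secures the hypothesis [0 < T] of [tableau_sound]. *)
Definition time_bound (x : word) : nat := ((p.[(size x + cert_bound x)%N])%R).+1.

Lemma accepting_view x u : size u <= cert_bound x ->
  ((tview M x u (time_bound x)).2 ord0 == Some (inl true)) = v x u.
Proof.
move=> le_u; have [halt out] := Mv x u; set t := (p.[_])%R in halt out.
have le_t : t <= time_bound x.
  by apply: leqW; apply: horner_nat_mono; rewrite leq_add2l.
have -> : tview M x u (time_bound x) = tview M x u t.
  by rewrite /tview /trace -(subnK le_t) iterD iter_halted.
move: out; rewrite /tview ffunE /word_of_tape -/(trace M x u t) /=.
by case: (Defs.thead _) => [[b|a]|] //= [->]; case: (v x u).
Qed.

Definition instance_d (x : word) : nat := nvalues M (cert_bound x) (time_bound x).
Definition instance_C (x : word) : nat -> nat -> nat -> nat -> bool :=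
  compatible M x (cert_bound x) (time_bound x).

Lemma verifier_selectable x : (exists u, size u <= cert_bound x /\ v x u) <->
  selectable (time_bound x).+1 (instance_d x) (instance_C x).
Proof.
split=> [[u [le_u vu]]|H].
  by apply: (tableau_complete (u := u)) => //; apply/eqP; rewrite accepting_view.
have [u le_u acc] := tableau_sound (ltn0Sn _) H.
by exists u; split=> //; rewrite -accepting_view //; apply/eqP.
Qed.

Definition edge (x : word) : nat -> nat -> bool :=
  nedge (time_bound x).+1 (instance_d x) (instance_C x).

Definition labels (i : nat) : nat := odd i.

Definition path_len (x : word) : nat := npath (time_bound x).+1 (instance_d x).
Definition values_len (x : word) : nat := (time_bound x).+1 * instance_d x.

Definition hom_reduction (x : word) : word :=
  poset_code (4 * ((time_bound x).+1 + path_len x)) (block_rel (edge x) 0) labels ++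
  poset_code (4 * (path_len x + values_len x))
    (block_rel (edge x) (time_bound x).+1) labels.

Definition core_reduction (x : word) : word :=
  poset_code (4 * nverts (time_bound x).+1 (instance_d x)) (block_rel (edge x) 0) labels.

Lemma hom_reductionP k x : 1 < k ->
  (exists u, size u <= cert_bound x /\ v x u) <-> kHOM k (hom_reduction x).
Proof.
move=> lt1k; rewrite verifier_selectable kHOM_code; try exact: block_data.
by rewrite -hom_instance.
Qed.

Lemma core_reductionP k x : 1 < k ->
  (exists u, size u <= cert_bound x /\ v x u) <-> kCORE k (core_reduction x).
Proof.
move=> lt1k; rewrite verifier_selectable kCORE_code; last exact: block_data.
by rewrite -core_instance.
Qed.

Lemma PF_cert_bound : PF (fun x u r => cert_bound x).
Proof. exact: PF_horner PF_size_x. Qed.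

Lemma PF_time_bound : PF (fun x u r => time_bound x).
Proof. exact: PF_succ (PF_horner _ (PF_add PF_size_x PF_cert_bound)). Qed.

Lemma PF_base : PF (fun x u r => base (cert_bound x) (time_bound x)).
Proof.
have := PF_cert_bound; have := PF_time_bound => HT HQ.
by rewrite /base; pf.
Qed.

Lemma PF_instance_d : PF (fun x u r => instance_d x).
Proof.
have HB := PF_base.
by rewrite /instance_d /nvalues; pf.
Qed.

Section Values.

Variable B : word -> word -> seq nat -> nat.
Hypothesis HB : PF B.

(** The number of views is a constant of [M], so [g] matters only on a finite table. *)
Lemma PF_view_table (g : nat -> nat) : PF (fun x u r => g (vview M (B x u r))).
Proof.
have H := PF_table (views M) g (PF_mod HB (PF_const (views M))).
by apply: PF_ext H => x u r; rewrite ltn_pmod // views_gt0.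
Qed.

Lemma PB_view_table (g : nat -> bool) : PB (fun x u r => g (vview M (B x u r))).
Proof. exact: (PF_view_table (fun z => nat_of_bool (g z))). Qed.

Lemma PF_vdigit j : PF (fun x u r =>
  vdigit M (cert_bound x) (time_bound x) j (B x u r)).
Proof. by have Hb := PF_base; rewrite /vdigit; pf. Qed.

End Values.

Lemma PB_unary_ok A B : PF A -> PF B -> PB (fun x u r =>
  unary_ok M x (cert_bound x) (time_bound x)  (A x u r) (B x u r)).
Proof.
move=> HA HB; have HT := PF_time_bound; have HQ := PF_cert_bound.
have HD := PF_vdigit HB; have Hz := PB_view_table HB.
rewrite /unary_ok; apply: PB_and; [|apply: PB_and; [|apply: PB_and; [|apply: PB_and]]].
- apply: PB_imp; first by pf.
  apply: PB_and; first exact: Hz.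
  by apply: PB_all_seq => i; apply: PB_eqn HT; apply: HD.
- by apply: PB_imp; [pf | apply: Hz].
- exact: PB_leq (HD 0) HQ.
- by apply: PB_all_seq => i; apply: PB_leq HA; apply: HD.
- apply: PB_all_seq => i; apply: PB_imp; first exact: PB_eqn (HD _) (PF_const 0).
  have Hh : PF (fun x u r => vhead (cert_bound x) (time_bound x) i (B x u r)) := HD _.
  have HL : PF (fun x u r => vlen M (cert_bound x) (time_bound x) (B x u r)) := HD _.
  rewrite /initial_ok; case: (nat_of_ord i) => [|[|k]].
  + apply: PB_if; [by pf | apply: PB_if; [by pf| exact: Hz|exact: Hz] | exact: Hz].
  + by apply: PB_if; [pf | apply: PB_or; apply: Hz | apply: Hz].
  + exact: Hz.
Qed.

Lemma PB_compatible A B A' B' : PF A -> PF B -> PF A' -> PF B' ->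
  PB (fun x u r => instance_C x (A x u r) (B x u r) (A' x u r) (B' x u r)).
Proof.
move=> HA HB HA' HB'; have HD := PF_vdigit HB; have HD' := PF_vdigit HB'.
have Hz := PB_view_table HB; have Hz' := PB_view_table HB'.
have Hn := PF_view_table HB; have Hn' := PF_view_table HB'.
rewrite /instance_C /compatible; apply: PB_and; first exact: PB_unary_ok.
apply: PB_and; first exact: PB_unary_ok.
have HS : PB (fun x u r => A' x u r == (A x u r).+1) by pf.
rewrite /binary_ok; apply: PB_and; [|apply: PB_and; [|apply: PB_and]].
- exact: PB_eqn (HD _) (HD' _).
- apply: PB_imp => //; apply: PB_and; first exact: PB_eqn (Hn _) (Hn' _).
  apply: PB_all_seq => i; apply: PB_eqn; apply: PF_add.
  + exact: HD'.
  + exact: Hz.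
  + exact: HD.
  + exact: Hz.
- apply: PB_all_seq => i; apply: PB_imp; first exact: PB_eqn (HD' _) (PF_succ HA).
  by apply: PB_and; apply: PB_eqn; [apply: HD | apply: HD' | apply: Hn | apply: Hn'].
- apply: PB_all_seq => i; apply: PB_imp.
    exact: PB_leq (PF_succ (HD' _)) (PF_succ HA).
  by apply: PB_neg; apply: PB_eqn; [apply: HD | apply: HD'].
Qed.

(** Eliminates the type [vertex] in favour of arithmetic on codes, to which the closure lemmas
    apply. *)
Lemma nedgeE m d C x y : nedge m d C x y =
  let top := 2 * m + 1 + m * d in
  let w z := z - (m + top.+2) in
  if x < m then
    if y < m then x < y else if y <= m + top then y - m == top else y == m + top.+1
  else if x <= m + top then
    if y < m then x - m == y else if y <= m + top then y - m == (x - m).+1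
    else (y == m + top.+1) || (x - m == w y %/ d)
  else if x == m + top.+1 then y != m + top.+1
  else
    if y < m then false
    else if y <= m + top then
      (y - m == top) || (y - m == 2 * m + 1 + (w x %/ d * d + w x %% d))
    else (y == m + top.+1) ||
      ((w x %/ d < w y %/ d) && C (w x %/ d) (w x %% d) (w y %/ d) (w y %% d)).
Proof.
rewrite /nedge /vdecode /=.
by repeat case: ifP => ? //=; apply/esym/eqP; lia.
Qed.

Lemma PB_edge A B : PF A -> PF B -> PB (fun x u r => edge x (A x u r) (B x u r)).
Proof.
move=> HA HB; have HT := PF_time_bound; have Hd := PF_instance_d.
pose Top x := 2 * (time_bound x).+1 + 1 + (time_bound x).+1 * instance_d x.
have Htop : PF (fun x u r => Top x) by rewrite /Top; pf.
have Hw F : PF F -> PF (fun x u r => F x u r - ((time_bound x).+1 + (Top x).+2)).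
  by move=> HF; pf.
have HC := PB_compatible (PF_div (Hw A HA) Hd) (PF_mod (Hw A HA) Hd)
  (PF_div (Hw B HB) Hd) (PF_mod (Hw B HB) Hd).
apply: (PB_ext (fun x u r => esym (nedgeE _ _ _ _ _))); cbv zeta.
apply: PB_if; first by pf.
  apply: PB_if; [by pf | by pf | apply: PB_if; by pf].
apply: PB_if; first by pf.
  apply: PB_if; [by pf | by pf | apply: PB_if; by pf].
apply: PB_if; [by pf | by pf |].
apply: PB_if; [by pf | by pf |].
apply: PB_if; [by pf | by pf |].
apply: PB_or; first by pf.
apply: PB_and; first by pf.
exact: HC.
Qed.

Lemma PB_block_rel L A B : PF L -> PF A -> PF B ->
  PB (fun x u r => block_rel (edge x) (L x u r) (A x u r) (B x u r)).
Proof.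
move=> HL HA HB; rewrite /block_rel /gadget_rel.
have HE := PB_edge (PF_add HL (PF_div HA (PF_const 4))) (PF_add HL (PF_div HB (PF_const 4))).
by pf.
Qed.

Lemma PW_block_code N L : PF N -> PF L ->
  PW (fun x u r => poset_code (N x u r) (block_rel (edge x) (L x u r)) labels).
Proof.
move=> HN HL; apply: (PW_poset_code (N := N)
  (R := fun x u r => block_rel (edge x) (L x u r)) (C := fun x u r => labels)) => //.
  by apply: PB_block_rel; pf.
by rewrite /labels; pf.
Qed.

Lemma polytime_hom_reduction : polytime hom_reduction.
Proof.
have HT := PF_time_bound; have Hd := PF_instance_d.
have Hp : PF (fun x u r => path_len x) by rewrite /path_len /npath; pf.
have Hv : PF (fun x u r => values_len x) by rewrite /values_len; pf.
apply: polytime_of; apply: PW_cat; apply: PW_block_code; by pf.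
Qed.

Lemma polytime_core_reduction : polytime core_reduction.
Proof.
have HT := PF_time_bound; have Hd := PF_instance_d.
apply: polytime_of; apply: PW_block_code; by rewrite /nverts; pf.
Qed.

End Acceptance.

Lemma NP_hard_kHOM k : 1 < k -> NP_hard (kHOM k).
Proof.
move=> lt1k L [v [q [[M [p Mv]] HL]]]; exists (hom_reduction M p q); split.
  exact: polytime_hom_reduction.
by move=> x; rewrite HL; apply: hom_reductionP.
Qed.

Lemma NP_hard_kCORE k : 1 < k -> NP_hard (kCORE k).
Proof.
move=> lt1k L [v [q [[M [p Mv]] HL]]]; exists (core_reduction M p q); split.
  exact: polytime_core_reduction.
by move=> x; rewrite HL; apply: core_reductionP.
Qed.

Theorem mainTheorem6 (k : nat) (hk : 1 < k) :
  NP_complete (kHOM k) /\ NP_complete (kCORE k).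
Proof.
split; split.
- exact: NP_kHOM.
- exact: NP_hard_kHOM.
- exact: NP_kCORE.
- exact: NP_hard_kCORE.
Qed.
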